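(* Let $p,q$ be coprime positive integers with $q$ odd. Let $C_{p,q}$ be the Chebyshev curve, $Y_{p,q}$ the preimage of $C_{p,q}$ in $\mathbb{C}^2\times(\mathbb{P}^1\setminus\{[1:0]\})\cong\mathbb{C}^2\times\mathbb{C}$ under the blow-up projection, and $D_{p,q}$ the proper transform of $C_{p,q}$ (all as defined in the context). (1) $Y_{p,q}$ consists of the non-singular curve $D_{p,q}$ and $(p-1)(q-1)/2$ exceptional lines in $\mathbb{C}^2\times\mathbb{C}$. (2) The character variety $X(G_{p,q})$ of the torus knot group $G_{p,q}=\langle\alpha,\beta\mid\alpha^p=\beta^q\rangle$ is birational to $Y_{p,q}$. More precisely, the reducible part $X^{red}(G_{p,q})$ is birational to $D_{p,q}$, and the irreducible part $X^{irr}(G_{p,q})$ is isomorphic to $Y_{p,q}\setminus D_{p,q}$.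
   Context: $C_k(z)$ ($k\in\mathbb{Z}$) is the Chebyshev polynomial of the first kind normalized by $C_0(z)=2$, $C_1(z)=z$, $C_{k+1}(z)=zC_k(z)-C_{k-1}(z)$, so $C_k(\zeta+\zeta^{-1})=\zeta^k+\zeta^{-k}$. Put $F(X,Y)=C_p(X)-C_q(Y)$, with partial derivatives $F_X,F_Y$. The Chebyshev curve is $C_{p,q}=\{(X,Y)\in\mathbb{C}^2\mid F(X,Y)=0\}$; its singular set $\mathrm{Sing}(C_{p,q})$ consists of the $(p-1)(q-1)/2$ nodes $(2\cos(a\pi/p),2\cos(b\pi/q))$ with $0<a<p$, $0<b<q$, $a\equiv b\pmod 2$. Let $B=\{(X,Y,[Z_0:Z_1])\in\mathbb{C}^2\times\mathbb{P}^1\mid F_X(X,Y)Z_0=-F_Y(X,Y)Z_1\}$ be the blow-up of $\mathbb{C}^2$ at the $(p-1)(q-1)$ common zeros $(2\cos(a\pi/p),2\cos(b\pi/q))$ ($0<a<p$, $0<b<q$) of $F_X,F_Y$, with projection $\pi:B\to\mathbb{C}^2$. The exceptional lines are the fibres of $\pi$ over these points. The curve $D_{p,q}$ is the closure $\overline{\pi^{-1}(C_{p,q}\setminus\mathrm{Sing}(C_{p,q}))}$ in $B$. The same symbol $\pi$ is used for the restriction of $\pi$ to $B\cap(\mathbb{C}^2\times(\mathbb{P}^1\setminus\{[1:0]\}))$, and $Y_{p,q}=\pi^{-1}(C_{p,q})$ in $\mathbb{C}^2\times(\mathbb{P}^1\setminus\{[1:0]\})$; inside $Y_{p,q}$, the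 curve $D_{p,q}$ and the exceptional lines are understood with their points having $[Z_0:Z_1]=[1:0]$ removed, and the exceptional lines in $Y_{p,q}$ are those over $\mathrm{Sing}(C_{p,q})$. The character of a homomorphism $\rho:G_{p,q}\to\mathrm{SL}_2(\mathbb{C})$ is $\chi_\rho(g)=\mathrm{tr}\,\rho(g)$; $X(G_{p,q})$ is the affine algebraic set of all characters, and $X^{irr}(G_{p,q})$, $X^{red}(G_{p,q})$ are the subsets of characters of irreducible, respectively reducible, representations ($\rho$ is reducible if some line in $\mathbb{C}^2$ is invariant under $\rho(G_{p,q})$). Birationality of the (reducible) algebraic sets $X(G_{p,q})$ and $Y_{p,q}$ is meant component by component, as made precise by the second sentence of (2). *)

(* Defs.v *)
From HB Require Import structures.
From mathcomp Require Import all_boot all_order all_algebra.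
From mathcomp Require Import complex mpoly.
From mathcomp Require Import boolp classical_sets functions cardinality reals.

Set Implicit Arguments.
Unset Strict Implicit.
Unset Printing Implicit Defensive.

Import GRing.Theory.

Local Open Scope classical_set_scope.
Local Open Scope ring_scope.
Local Open Scope quotient_scope.

(* Groups given by generators and relations. The pair (x, false) stands for   *)
(* the generator x and (x, true) for its inverse.                             *)

Section Presentation.
Context {T : choiceType}.

Definition word := seq (T * bool).

Definition gen_pow (x : T) (n : nat) : word := nseq n (x, false).

Definition winv (w : word) : word := rev [seq (x.1, ~~ x.2) | x <- w].

Context (rel : word -> word -> Prop).

Inductive pres_eq : word -> word -> Prop :=
| pres_refl u : pres_eq u u
| pres_sym u v : pres_eq u v -> pres_eq v u
| pres_trans u v w : pres_eq u v -> pres_eq v w -> pres_eq u w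
| pres_cat u u' v v' :
    pres_eq u u' -> pres_eq v v' -> pres_eq (u ++ v) (u' ++ v')
| pres_cancel x b : pres_eq [:: (x, b); (x, ~~ b)] [::]
| pres_rel u v : rel u v -> pres_eq u v.

Definition pres_eqb (u v : word) : bool := `[< pres_eq u v >].

Lemma pres_eqb_refl : reflexive pres_eqb.
Proof. by move=> u; apply/asboolP; exact: pres_refl. Qed.

Lemma pres_eqb_sym : ssrbool.symmetric pres_eqb.
Proof. by move=> u v; apply/asboolP/asboolP => /pres_sym. Qed.

Lemma pres_eqb_trans : transitive pres_eqb.
Proof.
by move=> v u w /asboolP uv /asboolP vw; apply/asboolP; exact: pres_trans vw.
Qed.

Canonical pres_equiv :=
  EquivRel pres_eqb pres_eqb_refl pres_eqb_sym pres_eqb_trans.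

Definition pres_group := {eq_quot pres_equiv}.

HB.instance Definition _ := Choice.on pres_group.
HB.instance Definition _ := EqQuotient.on pres_group.

Definition pres_class (w : word) : pres_group := \pi_pres_group w.

Lemma pres_classP u v : pres_class u = pres_class v <-> pres_eq u v.
Proof.
split=> [/eqquotP/asboolP //|uv]; apply/eqquotP; exact/asboolP.
Qed.

Lemma pres_reprK g : pres_class (repr g) = g.
Proof. exact: reprK. Qed.

Lemma pres_repr_class w : pres_eq (repr (pres_class w)) w.
Proof. by apply/pres_classP; rewrite pres_reprK. Qed.

Lemma winv_cat u v : winv (u ++ v) = winv v ++ winv u.
Proof. by rewrite /winv map_cat rev_cat. Qed.

Lemma winvK : involutive winv.
Proof.
move=> w; rewrite /winv map_rev revK -map_comp -[RHS]map_id.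
by apply: eq_map => -[x b] /=; rewrite negbK.
Qed.

Lemma pres_mulwV w : pres_eq (w ++ winv w) [::].
Proof.
elim: w => [|[x b] w IHw]; first exact: pres_refl.
rewrite -cat1s winv_cat -catA (catA w).
apply: pres_trans (pres_cancel x b).
rewrite -[X in pres_eq _ X]cat1s.
apply: pres_cat; first exact: pres_refl.
rewrite -[X in pres_eq _ X]cat0s.
by apply: pres_cat => //; exact: pres_refl.
Qed.

Lemma pres_mulVw w : pres_eq (winv w ++ w) [::].
Proof. by rewrite -{2}(winvK w); exact: pres_mulwV. Qed.

Lemma pres_winv u v : pres_eq u v -> pres_eq (winv u) (winv v).
Proof.
move=> uv; apply: (@pres_trans _ (winv u ++ (v ++ winv v))).
  rewrite -{1}[winv u]cats0; apply: pres_cat; first exact: pres_refl.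
  exact/pres_sym/pres_mulwV.
rewrite catA -[X in pres_eq _ X]cat0s; apply: pres_cat; last exact: pres_refl.
apply: (@pres_trans _ (winv u ++ u)); last exact: pres_mulVw.
by apply: pres_cat; [exact: pres_refl | exact: pres_sym].
Qed.

Definition pres_one : pres_group := pres_class [::].
Definition pres_mul (g h : pres_group) : pres_group :=
  pres_class (repr g ++ repr h).
Definition pres_inv (g : pres_group) : pres_group := pres_class (winv (repr g)).

Lemma pres_mulE u v :
  pres_mul (pres_class u) (pres_class v) = pres_class (u ++ v).
Proof. by apply/pres_classP/pres_cat; exact: pres_repr_class. Qed.

Lemma pres_invE u : pres_inv (pres_class u) = pres_class (winv u).
Proof. by apply/pres_classP/pres_winv; exact: pres_repr_class. Qed.

Lemma pres_mulA : associative pres_mul.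
Proof.
move=> g h k; rewrite -[g]pres_reprK -[h]pres_reprK -[k]pres_reprK.
by rewrite !pres_mulE catA.
Qed.

Lemma pres_mul1 : left_id pres_one pres_mul.
Proof. by move=> g; rewrite -[g]pres_reprK pres_mulE. Qed.

Lemma pres_mulg1 : right_id pres_one pres_mul.
Proof. by move=> g; rewrite -[g]pres_reprK pres_mulE cats0. Qed.

Lemma pres_mulV : left_inverse pres_one pres_inv pres_mul.
Proof.
move=> g; rewrite -[g]pres_reprK pres_invE pres_mulE.
exact/pres_classP/pres_mulVw.
Qed.

Lemma pres_mulgV : right_inverse pres_one pres_inv pres_mul.
Proof.
move=> g; rewrite -[g]pres_reprK pres_invE pres_mulE.
exact/pres_classP/pres_mulwV.
Qed.

HB.instance Definition _ := isGroup.Build pres_group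
  pres_mulA pres_mul1 pres_mulg1 pres_mulV pres_mulgV.

End Presentation.

(* The generators alpha and beta are true and false.                          *)
Definition torus_knot_rel (p q : nat) (u v : @word bool) : Prop :=
  u = gen_pow true p /\ v = gen_pow false q.

Definition torus_knot_group (p q : nat) : groupType :=
  pres_group (torus_knot_rel p q).

(* Algebraic subsets of the affine space of functions I -> C. The index type  *)
(* I may be infinite: a polynomial function involves finitely many            *)
(* coordinates. This lets a character variety live in the space of functions  *)
(* on the group, where the coordinates are the evaluations chi |-> chi g; its *)
(* regular functions are then those of the usual models in C^n obtained by    *)
(* choosing finitely many generating trace functions.                         *)

Section AffineGeometry.
Context {R : realType}.
Local Notation C := (R[i]).

Section Zariski.
Context {I : Type}.
Implicit Types (A S K U Z : set (I -> C)) (f : (I -> C) -> C).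

Definition polyfun f : Prop :=
  exists (n : nat) (idx : 'I_n -> I) (P : {mpoly C[n]}),
    forall x, f x = P.@[fun k => x (idx k)].

Definition zclosed Z : Prop :=
  exists2 E : set ((I -> C) -> C), E `<=` polyfun &
    Z = [set x | forall f, E f -> f x = 0].

Definition zclosed_in S A : Prop := exists2 Z, zclosed Z & A = S `&` Z.

Definition zopen_in S A : Prop := exists2 Z, zclosed Z & A = S `\` Z.

Definition zdense_in S A : Prop :=
  A `<=` S /\ forall Z, zclosed Z -> A `<=` Z -> S `<=` Z.

Definition zirreducible S : Prop :=
  S !=set0 /\ forall Z1 Z2, zclosed Z1 -> zclosed Z2 ->
    S `<=` Z1 `|` Z2 -> S `<=` Z1 \/ S `<=` Z2.

Definition zcomponents S : set (set (I -> C)) :=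
  [set K | [/\ zirreducible K, K `<=` S &
    forall K', zirreducible K' -> K `<=` K' -> K' `<=` S -> K' = K]].

Definition zchain S (d : nat) : Prop :=
  exists Z : nat -> set (I -> C),
    (forall i, (i <= d)%N -> zirreducible (Z i) /\ zclosed_in S (Z i)) /\
    (forall i, (i < d)%N -> Z i `<` Z i.+1).

Definition zdim S (d : nat) : Prop := zchain S d /\ ~ zchain S d.+1.

Definition regular_on S f : Prop :=
  forall x, S x -> exists P Q, [/\ polyfun P, polyfun Q, Q x != 0 &
    forall y, S y -> Q y != 0 -> f y = P y / Q y].

End Zariski.

Definition regular_map {I J : Type} (A : set (I -> C)) (B : set (J -> C))
    (phi : (I -> C) -> (J -> C)) : Prop :=
  (forall x, A x -> B (phi x)) /\
  (forall j, regular_on A (fun x => phi x j)).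

Definition isomorphic {I J : Type} (A : set (I -> C)) (B : set (J -> C)) :
    Prop :=
  exists phi psi, [/\ regular_map A B phi, regular_map B A psi,
    forall x, A x -> psi (phi x) = x & forall y, B y -> phi (psi y) = y].

Definition birational {I J : Type} (A : set (I -> C)) (B : set (J -> C)) :
    Prop :=
  exists U V, [/\ zopen_in A U /\ zdense_in A U,
    zopen_in B V /\ zdense_in B V & isomorphic U V].

Definition birational_by_components {I J : Type}
    (A : set (I -> C)) (B : set (J -> C)) : Prop :=
  exists Phi : set (I -> C) -> set (J -> C),
    set_bij (zcomponents A) (zcomponents B) Phi /\
    forall K, zcomponents A K -> birational K (Phi K).

Section FiniteDimension.
Context {n : nat}.
Implicit Types S : set ('I_n -> C).

Definition curve S : Prop :=
  [/\ zclosed S, S !=set0 & forall K, zcomponents S K -> zdim K 1].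

Definition tangent_space S (x : 'I_n -> C) : set 'rV[C]_n :=
  [set v | forall f : {mpoly C[n]}, (forall y, S y -> f.@[y] = 0) ->
    \sum_i (f^`M(i)).@[x] * v 0 i = 0].

Definition nonsingular_curve S : Prop :=
  curve S /\ forall x, S x -> exists2 T : {vspace 'rV[C]_n},
    \dim T = 1%N & tangent_space S x = [set v | v \in T].

Definition affine_line S : Prop :=
  exists a d : 'I_n -> C, (exists i, d i != 0) /\
    S = [set x | exists t : C, forall i, x i = a i + t * d i].

End FiniteDimension.

(* The points of the projective line are the lines through 0 in C^2.          *)
Definition P1 := {L : {vspace 'rV[C]_2} | \dim L == 1%N}.

Definition C2P1 : Type := ('I_2 -> C) * P1.

Definition affine_vec (w : C) : 'rV[C]_2 :=
  \row_(j < 2) if j == ord0 then w else 1.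

Lemma dim_affine_vec w : \dim <[affine_vec w]>%VS == 1%N.
Proof.
rewrite dim_vline eqb1; apply/eqP => w0.
have /eqP := congr1 (fun v : 'rV[C]_2 => v 0 ord_max) w0.
by rewrite !mxE oner_eq0.
Qed.

(* The point [w : 1]; these are the points other than [1 : 0].                *)
Definition P1_affine (w : C) : P1 :=
  exist _ <[affine_vec w]>%VS (dim_affine_vec w).

(* Zariski closure in C^2 x P^1: closed sets are the zero sets of polynomials *)
(* in (X, Y), (Z0, Z1) that are homogeneous in (Z0, Z1).                      *)
Definition vanishes_at (f : {mpoly {mpoly C[2]}[2]}) (P : C2P1) : Prop :=
  forall z : 'rV[C]_2, z \in val P.2 ->
    (map_mpoly (meval P.1) f).@[fun j => z 0 j] = 0.

Definition closure_C2P1 (S : set C2P1) : set C2P1 :=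
  [set P | forall (d : nat) (f : {mpoly {mpoly C[2]}[2]}), f \is d.-homog ->
    (forall Q, S Q -> vanishes_at f Q) -> vanishes_at f P].

(* The isomorphism of C^3 = C^2 x C onto C^2 x (P^1 \ {[1 : 0]}).             *)
Definition chart (x : 'I_3 -> C) : C2P1 :=
  (fun j : 'I_2 => x (lshift 1 j), P1_affine (x ord_max)).

End AffineGeometry.

Arguments P1 R : clear implicits.
Arguments C2P1 R : clear implicits.

Section ChebyshevCurve.
Context (R : realType).
Local Notation C := (R[i]).

Fixpoint cheb (k : nat) : {poly C} :=
  match k with
  | 0 => 2%:P
  | k1.+1 => match k1 with
             | 0 => 'X
             | k2.+1 => 'X * cheb k1 - cheb k2
             end
  end.

Context (p q : nat).

Definition chebF : {mpoly C[2]} :=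
  (map_poly (@mpolyC 2 C) (cheb p)).['X_ord0] -
  (map_poly (@mpolyC 2 C) (cheb q)).['X_ord_max].

Definition chebFX : {mpoly C[2]} := chebF^`M(ord0).
Definition chebFY : {mpoly C[2]} := chebF^`M(ord_max).

Definition cheb_curve : set ('I_2 -> C) := [set x | chebF.@[x] = 0].

(* F is squarefree, so these are the singular points of the plane curve F = 0. *)
Definition cheb_sing : set ('I_2 -> C) :=
  [set x | [/\ chebF.@[x] = 0, chebFX.@[x] = 0 & chebFY.@[x] = 0]].

Definition cheb_blowup : set (C2P1 R) :=
  [set P : C2P1 R | forall z : 'rV[C]_2, z \in val P.2 ->
    chebFX.@[P.1] * z 0 ord0 = - chebFY.@[P.1] * z 0 ord_max].

Definition blowup_preimage (S : set ('I_2 -> C)) : set (C2P1 R) :=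
  cheb_blowup `&` [set P : C2P1 R | S P.1].

Definition cheb_proper_transform : set (C2P1 R) :=
  cheb_blowup `&`
  closure_C2P1 (blowup_preimage (cheb_curve `\` cheb_sing)).

Definition Ycurve : set ('I_3 -> C) := chart @^-1` blowup_preimage cheb_curve.

Definition Dcurve : set ('I_3 -> C) := chart @^-1` cheb_proper_transform.

Definition exceptional_line (s : 'I_2 -> C) : set ('I_3 -> C) :=
  chart @^-1` blowup_preimage [set s].

Definition exceptional_lines : set (set ('I_3 -> C)) :=
  exceptional_line @` cheb_sing.

End ChebyshevCurve.

Section CharacterVariety.
Context (R : realType) (G : groupType).
Local Notation C := (R[i]).
Implicit Types rho : G -> 'M[C]_2.

Definition SL2_rep rho : Prop :=
  (forall g, \det (rho g) = 1) /\
  (forall g h, rho (g * h)%g = rho g *m rho h).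

Definition reducible_rep rho : Prop :=
  exists2 v : 'cV[C]_2, v != 0 & forall g, exists c : C, rho g *m v = c *: v.

Definition rep_char rho : G -> C := fun g => \tr (rho g).

Definition char_variety : set (G -> C) :=
  [set chi | exists2 rho, SL2_rep rho & chi = rep_char rho].

Definition char_variety_red : set (G -> C) :=
  [set chi | exists2 rho, SL2_rep rho /\ reducible_rep rho & chi = rep_char rho].

Definition char_variety_irr : set (G -> C) :=
  [set chi | exists2 rho, SL2_rep rho /\ ~ reducible_rep rho &
    chi = rep_char rho].

End CharacterVariety.

Arguments cheb R k : clear implicits.
Arguments chebF R p q : clear implicits.
Arguments chebFX R p q : clear implicits.
Arguments chebFY R p q : clear implicits.
Arguments cheb_curve R p q _ : clear implicits.
Arguments cheb_sing R p q _ : clear implicits.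
Arguments cheb_blowup R p q _ : clear implicits.
Arguments blowup_preimage R p q S _ : clear implicits.
Arguments cheb_proper_transform R p q _ : clear implicits.
Arguments Ycurve R p q _ : clear implicits.
Arguments Dcurve R p q _ : clear implicits.
Arguments exceptional_line R p q s _ : clear implicits.
Arguments exceptional_lines R p q _ : clear implicits.
Arguments char_variety R G _ : clear implicits.
Arguments char_variety_red R G _ : clear implicits.
Arguments char_variety_irr R G _ : clear implicits.

(* Main.v *)
Require Import Defs.
From mathcomp Require Import all_boot all_order all_algebra.
From mathcomp Require Import separable complex mpoly ring zify.
From mathcomp Require Import boolp classical_sets functions cardinality reals.

(* Write C_k and U_k for the Chebyshev polynomials of both kinds. The curve
   C_p(X) = C_q(Y) is parametrized by X = C_q(t), Y = C_p(t), and since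
   C_k' = k U_k the blow-up coordinate along it is w = q U_q(t) / (p U_p(t)),
   which is defined for U_p(t) <> 0. With W = p w / q and m p = n q + 1, the
   parameter is the polynomial
     t = (C_m(Y) C_n(X) - U_m(Y) U_n(X) W (Y^2 - 4)) / 2
   of (X, Y, w), so D is a closed smooth rational curve. Over a node, where
   U_p(X) = U_q(Y) = 0, it consists of the two points W^2 (Y^2 - 4) = X^2 - 4.

   A reducible character is that of a diagonal representation alpha -> z^q,
   beta -> z^p, and t = z + 1/z parametrizes these. An irreducible
   representation is conjugate to alpha -> [a, 1; 0, 1/a], beta -> [b, 0; u, 1/b]
   with u <> 0; by Cayley-Hamilton the off-diagonal entries of
   alpha^p = beta^q are U_p(X) = 0 and U_q(Y) u = 0, where X and Y are the traces
   of alpha and beta. So (X, Y) is a node, and u is a free parameter subject to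
   irreducibility, which reads (2 Z - X Y)^2 <> (X^2 - 4)(Y^2 - 4) for
   Z = tr(alpha beta). Matching 2 Z - X Y = W (Y^2 - 4) identifies these punctured
   lines with the exceptional lines minus D. As q is odd, Y -> -Y exchanges the
   roots of U_q with C_q(Y) = 2 and C_q(Y) = -2, which gives the number of nodes. *)

Set Implicit Arguments.
Unset Strict Implicit.
Unset Printing Implicit Defensive.

Import GRing.Theory Num.Theory.

Local Open Scope classical_set_scope.
Local Open Scope ring_scope.
Local Open Scope card_scope.

(** * Chebyshev polynomials *)

(** Every component on either side is handled through one notion: the image of a line minus finitely
    many points under a rational map [g] that has a polynomial left inverse [tau]. This replaces
    coordinate rings, which are awkward because characters live in the space of functions on the
    whole group: a polynomial function pulls back to a rational function of one variable, so
    irreducibility, dimension and birationality reduce to the finiteness of root sets. The formula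
    for t comes from the group. Put a = z^q and b = z^p, so that b^m / a^n = z by the Bezout
    relation. The trace of this element is half of C_m(Y) C_n(X) - U_m(Y) U_n(X) (b - 1/b)(a - 1/a).
    Along the curve a - 1/a = W (b - 1/b), so the last product is W (Y^2 - 4) and z is
    eliminated. *)

Lemma nat_ind2 (P : nat -> Prop) :
  P 0 -> P 1 -> (forall k, P k -> P k.+1 -> P k.+2) -> forall k, P k.
Proof.
move=> P0 P1 PS k; suff [] : P k /\ P k.+1 by [].
by elim: k => [//|k [Pk PSk]]; split=> //; exact: PS.
Qed.

Section Chebyshev.
Context {R : realType}.
Local Notation C := (R[i]).
Implicit Types (z t x y w : C) (k m n p q : nat).

Local Notation T := (cheb R).

(* C_k is the first kind; with this indexing U_k is the second kind polynomial of
   degree k - 1, so that U_k(z + 1/z) (z - 1/z) = z^k - z^-k and C_k' = k U_k. *)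
Fixpoint chebU (k : nat) : {poly C} :=
  match k with
  | 0 => 0
  | k1.+1 => match k1 with
             | 0 => 1
             | k2.+1 => 'X * chebU k1 - chebU k2
             end
  end.
Local Notation U := chebU.

Lemma chebSS k : T k.+2 = 'X * T k.+1 - T k. Proof. by []. Qed.
Lemma chebUSS k : U k.+2 = 'X * U k.+1 - U k. Proof. by []. Qed.

(** The identity principle used throughout: [P * N] vanishes everywhere, in particular at more
    integers than its degree allows, and these are distinct in characteristic zero. *)
Lemma poly_nonroot (P : {poly C}) (N : {poly C}) :
  P != 0 -> (forall x, N.[x] != 0 -> P.[x] = 0) -> N = 0.
Proof.
move=> P0 PN; suff : P * N = 0.
  by move/eqP; rewrite mulf_eq0 (negbTE P0) => /eqP.
set M := P * N.
apply: (@roots_geq_poly_eq0 _ _ [seq i%:R | i <- iota 0 (size M)]).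
- apply/allP => x _; rewrite /root hornerM mulf_eq0.
  by have [//|/PN ->] := eqVneq N.[x] 0; rewrite ?orbT ?eqxx.
- by rewrite map_inj_uniq ?iota_uniq // => i j /eqP; rewrite eqr_nat => /eqP.
- by rewrite size_map size_iota.
Qed.

Lemma poly_ext (P Q : {poly C}) : (forall x, P.[x] = Q.[x]) -> P = Q.
Proof.
move=> PQ; apply/eqP; rewrite -subr_eq0.
apply: contraTT (oner_neq0 {poly C}) => PQ0; rewrite negbK.
by apply/eqP/(poly_nonroot PQ0) => x _; rewrite hornerD hornerN PQ subrr.
Qed.

Lemma exists_laurent t : exists2 z : C, z != 0 & t = z + z^-1.
Proof.
(* The equation solved is z^2 = t z - 1, whose constant term keeps z away from 0. *)
have [z] := @solve_monicpoly C 2 (fun i => if i == 0%N then -1 else t) isT.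
rewrite !big_ord_recl big_ord0 /= expr0 expr1 mulr1 addr0 => e.
have z0 : z != 0.
  apply: contra_eq_neq e => ->.
  by rewrite expr0n /= mulr0 addr0 eq_sym oppr_eq0 oner_eq0.
exists z => //; apply: (mulIf z0).
by rewrite mulrDl mulVf // -expr2 e; ring.
Qed.

Lemma cheb_laurent k z : z != 0 -> (T k).[z + z^-1] = z ^+ k + z ^- k.
Proof.
move=> z0; elim/nat_ind2: k => [||k IH0 IH1].
- by rewrite /= hornerC expr0 invr1.
- by rewrite /= hornerX expr1.
- have zk0 : z ^+ k != 0 by rewrite expf_neq0.
  by rewrite chebSS hornerD hornerM hornerX hornerN IH0 IH1 !exprS; field; apply/andP.
Qed.

Lemma chebU_laurent k z :
  z != 0 -> (U k).[z + z^-1] * (z - z^-1) = z ^+ k - z ^- k.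
Proof.
move=> z0; elim/nat_ind2: k => [||k IH0 IH1].
- by rewrite /= horner0 expr0 invr1 mul0r subrr.
- by rewrite /= hornerC expr1 mul1r.
- have zk0 : z ^+ k != 0 by rewrite expf_neq0.
  rewrite chebUSS hornerD hornerM hornerX hornerN mulrBl -mulrA IH0 IH1 !exprS.
  by field; apply/andP.
Qed.

Lemma cheb_comp m n t : (T m).[(T n).[t]] = (T (n * m)).[t].
Proof.
have [z z0 ->] := exists_laurent t.
by rewrite !cheb_laurent ?expf_neq0 // !exprM.
Qed.

Lemma cheb_chebU k : T k.+1 = U k.+2 - U k.
Proof.
elim/nat_ind2: k => [||k IH0 IH1]; first by rewrite /=; ring.
  by rewrite /= polyC_natr; ring.
by rewrite chebSS IH0 IH1 (chebUSS k.+2) (chebUSS k.+1) (chebUSS k); ring.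
Qed.

Lemma deriv_cheb k : (T k)^`() = k%:R *: U k.
Proof.
elim/nat_ind2: k => [||k IH0 IH1].
- by rewrite /= derivC scaler0.
- by rewrite /= derivX scale1r.
- rewrite chebSS derivB derivM derivX IH0 IH1 cheb_chebU.
  by rewrite -!mul_polyC !polyC_natr chebUSS -(addn2 k) -(addn1 k); ring.
Qed.

Lemma chebU_2 k : (U k).[2] = k%:R.
Proof.
elim/nat_ind2: k => [||k IH0 IH1]; rewrite /= ?horner0 ?hornerC //.
rewrite hornerD hornerM hornerX hornerN -/(U k.+1) IH0 IH1.
by rewrite -[k.+2]addn2 -addn1; ring.
Qed.

Lemma cheb_opp k t : (T k).[- t] = (-1) ^+ k * (T k).[t].
Proof.
elim/nat_ind2: k => [||k IH0 IH1]; rewrite /= ?hornerC ?hornerX ?mul1r ?expr1 ?mulN1r //.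
by rewrite !(hornerD, hornerM, hornerX, hornerN) -/(T k.+1) IH0 IH1 !exprS; ring.
Qed.

Lemma chebU_opp k t : (U k).[- t] = (-1) ^+ k.+1 * (U k).[t].
Proof.
elim/nat_ind2: k => [||k IH0 IH1].
- by rewrite /= !horner0 mulr0.
- by rewrite /= !hornerC; ring.
by rewrite /= !(hornerD, hornerM, hornerX, hornerN) -/(U k.+1) IH0 IH1 !exprS; ring.
Qed.

(** The chain rule for [T m \Po T n = T (n * m)]. The factor n m is cancelled from both derivatives,
    so the zero indices are split off beforehand. *)
Lemma chebU_comp m n t :
  (U m).[(T n).[t]] * (U n).[t] = (U (n * m)).[t].
Proof.
have [->|m0] := posnP m; first by rewrite muln0 /= !horner0 mul0r.
have [->|n0] := posnP n; first by rewrite mul0n /= !horner0 mulr0.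
have : T m \Po T n = T (n * m).
  by apply: poly_ext => x; rewrite horner_comp cheb_comp.
move=> /(congr1 (fun P => P^`().[t])).
rewrite deriv_comp !deriv_cheb hornerM horner_comp !hornerZ natrM => e.
have nm0 : (n%:R * m%:R : C) != 0 by rewrite mulf_neq0 // pnatr_eq0 -lt0n.
by apply: (mulfI nm0); rewrite -e; ring.
Qed.

(** Pell's equation: for t = z + 1/z both sides are the square of z^k - z^-k. *)
Lemma chebU_sqr k t : (T k).[t] ^+ 2 - 4 = (t ^+ 2 - 4) * (U k).[t] ^+ 2.
Proof.
have [z z0 ->] := exists_laurent t.
have -> : (z + z^-1) ^+ 2 - 4 = (z - z^-1) ^+ 2 by field.
rewrite -exprMn [_ * (U k).[_]]mulrC chebU_laurent // cheb_laurent //.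
by field; rewrite expf_neq0.
Qed.

Lemma chebU_root_neq k t : (0 < k)%N -> (U k).[t] = 0 -> t ^+ 2 - 4 != 0.
Proof.
move=> k0 Ut; have -> : t ^+ 2 - 4 = (t - 2) * (t + 2) by ring.
apply/eqP => /eqP.
rewrite mulf_eq0 subr_eq0 addr_eq0 => /orP[] /eqP e; move: Ut; rewrite e.
  by rewrite chebU_2 => /eqP; rewrite pnatr_eq0 eqn0Ngt k0.
by rewrite chebU_opp chebU_2 => /eqP; rewrite mulf_eq0 signr_eq0 pnatr_eq0 eqn0Ngt k0.
Qed.

Lemma chebU_root_cheb k t : (U k).[t] = 0 -> (T k).[t] = 2 \/ (T k).[t] = -2.
Proof.
move=> Ut; have := chebU_sqr k t; rewrite Ut.
have -> : (T k).[t] ^+ 2 - 4 = ((T k).[t] - 2) * ((T k).[t] + 2) by ring.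
rewrite expr0n mulr0 => /eqP; rewrite mulf_eq0 subr_eq0 addr_eq0.
by case/orP=> /eqP; [left|right].
Qed.

Lemma chebU_neq0 k : (0 < k)%N -> U k != 0.
Proof.
move=> k0; apply/eqP => /(congr1 (fun P : {poly C} => P.[2])).
by rewrite chebU_2 horner0 => /eqP; rewrite pnatr_eq0 -[_ == _]negbK -lt0n k0.
Qed.

Lemma coprime_expr_eq1 z m n :
  coprime m n -> z != 0 -> z ^+ m = 1 -> z ^+ n = 1 -> z = 1.
Proof.
move=> /eqP g1 z0 zm zn.
have [m0|m0] := posnP m; first by move: g1; rewrite m0 gcd0n => n1; rewrite n1 in zn.
have [km kn e _] := egcdnP n m0.
have := congr1 (fun k => z ^+ k) e.
by rewrite g1 exprD !(mulnC _ m, mulnC _ n) !exprM zm zn !expr1n mul1r expr1.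
Qed.

(** A common root z + 1/z would make z^2 a root of unity of order dividing both m and n, hence 1.
    This leaves only t = 2 and t = -2, where U_m is m up to sign. *)
Lemma chebU_coprime m n t : coprime m n -> (0 < m)%N ->
  (U m).[t] = 0 -> (U n).[t] = 0 -> False.
Proof.
move=> co m0 Um Un; have := chebU_root_neq m0 Um.
have [z z0 et] := exists_laurent t.
have unit_sqr k : (U k).[t] = 0 -> (z ^+ 2) ^+ k = 1.
  move=> Uk; have := chebU_laurent k z0; rewrite -et Uk mul0r => /esym/eqP.
  rewrite subr_eq0 => /eqP e.
  by rewrite -exprM mulnC exprM expr2 {2}e mulfV ?expf_neq0.
have z2 : z ^+ 2 = 1.
  by apply: (coprime_expr_eq1 co); rewrite ?expf_neq0 ?unit_sqr.
have zV : z^-1 = z by apply: (mulfI z0); rewrite mulfV // -expr2.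
suff -> : t ^+ 2 - 4 = 0 by rewrite eqxx.
have -> : t ^+ 2 - 4 = 4 * z ^+ 2 - 4 by rewrite et zV; ring.
by rewrite z2 mulr1 subrr.
Qed.

Lemma size_cheb k : (0 < k)%N -> size (T k) = k.+1.
Proof.
suff: size (T k.+1) = k.+2 /\ size (T k) = (if k == 0%N then 1%N else k.+1).
  by case: k => [//|k] [_ ->].
elim: k => [|k [IH1 IH0]].
  by rewrite /= size_polyX size_polyC pnatr_eq0.
split; last by rewrite IH1.
have e : size ('X * T k.+1) = k.+3.
  by rewrite mulrC size_mulX ?IH1 // -size_poly_gt0 IH1.
rewrite chebSS size_polyDl ?e // size_polyN IH0.
by case: (k == 0%N); rewrite ltnS // ltnW.
Qed.

Lemma size_chebU k : size (U k) = k.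
Proof.
suff: size (U k.+1) = k.+1 /\ size (U k) = k by case.
elim: k => [|k [IH1 IH0]]; first by rewrite /= size_poly1 size_poly0.
split; last by rewrite IH1.
have e : size ('X * U k.+1) = k.+2.
  by rewrite mulrC size_mulX ?IH1 // -size_poly_gt0 IH1.
by rewrite chebUSS size_polyDl ?e // size_polyN IH0 ltnS ltnW.
Qed.

(** Differentiating Pell's equation and cancelling 2 U_k gives k C_k = X U_k + (X^2 - 4) U_k'. At a
    double root C_k would vanish, whereas it is 2 or -2 at every root of U_k. *)
Lemma chebU_simple_root k t : (U k).[t] = 0 -> (0 < k)%N -> (U k)^`().[t] != 0.
Proof.
move=> Ut k0; apply/eqP => U't.
have Uk0 := chebU_neq0 k0.
have sq : T k ^+ 2 - 4%:P = ('X ^+ 2 - 4%:P) * U k ^+ 2.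
  by apply: poly_ext => x; rewrite !(hornerD, hornerN, hornerM, hornerC, horner_exp, hornerX) chebU_sqr.
have /(mulfI Uk0) e : U k * (k%:R *: T k) = U k * ('X * U k + ('X ^+ 2 - 4%:P) * (U k)^`()).
  have n20 : (2 : {poly C}) != 0 by rewrite -polyC_natr polyC_eq0 pnatr_eq0.
  apply: (mulfI n20); have := congr1 deriv sq.
  rewrite !(derivB, derivM, derivC, derivXn, derivX, derivXn, deriv_exp) deriv_cheb /=.
  by rewrite -!mul_polyC !polyC_natr => e; rewrite -[LHS]addr0; ring: e.
have := congr1 (fun P : {poly C} => P.[t]) e.
rewrite hornerZ hornerD !hornerM Ut U't !mulr0 addr0 => /eqP.
rewrite mulf_eq0 pnatr_eq0 eqn0Ngt k0 /=.
by case: (chebU_root_cheb Ut) => ->; rewrite ?oppr_eq0 pnatr_eq0.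
Qed.

Lemma chebU_roots k : (0 < k)%N -> exists rs : seq C,
  [/\ uniq rs, size rs = k.-1 & forall x, (x \in rs) = ((U k).[x] == 0)].
Proof.
move=> k0; have [rs def_rs] := closed_field_poly_normal (U k).
have lc0 : lead_coef (U k) != 0 by rewrite lead_coef_eq0 chebU_neq0.
have mem x : (x \in rs) = ((U k).[x] == 0).
  by rewrite -root_prod_XsubC -(rootZ x _ lc0) -def_rs.
exists rs; split=> //.
- rewrite -separable_prod_XsubC unlock.
  apply/Pdiv.ClosedField.coprimepP => x.
  rewrite root_prod_XsubC mem => /eqP /chebU_simple_root/(_ k0).
  by rewrite {1}def_rs derivZ hornerZ mulf_eq0 (negbTE lc0).
- by have := congr1 (fun P : {poly C} => size P) def_rs;
    rewrite size_scale // size_prod_XsubC size_chebU => ->.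
Qed.

Lemma count_chebU_roots k (rs : seq C) c : odd k -> uniq rs -> size rs = k.-1 ->
  (forall x, (x \in rs) = ((U k).[x] == 0)) -> c = 2 \/ c = -2 ->
  count (fun y => (T k).[y] == c) rs = k.-1./2.
Proof.
move=> ok urs srs mem.
have opp_rs : perm_eq [seq - x | x <- rs] rs.
  apply: uniq_perm => // [|x]; first by rewrite map_inj_uniq //; exact: oppr_inj.
  rewrite -{1}[x]opprK mem_map ?mem; last exact: oppr_inj.
  by rewrite chebU_opp mulf_eq0 signr_eq0.
have opp_c d : count (fun y => (T k).[y] == d) rs = count (fun y => (T k).[y] == - d) rs.
  rewrite -(permP opp_rs) count_map; apply: eq_count => x /=.
  by rewrite cheb_opp -signr_odd ok expr1 mulN1r eqr_oppLR.
have half : count (fun y => (T k).[y] == 2) rs = k.-1./2.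
  (* The roots where the value is not 2 are those where it is -2, equally many by symmetry; the
     total is thus twice the count and halving is exact. *)
  rewrite -srs -(count_predC (fun y => (T k).[y] == 2) rs).
  rewrite (_ : count (predC _) rs = count (fun y => (T k).[y] == 2) rs) ?addnn ?doubleK //.
  rewrite [RHS]opp_c; apply: eq_in_count => y; rewrite mem => /eqP /chebU_root_cheb /= [] ->.
    by rewrite eqxx; apply/esym/negbTE; rewrite -subr_eq0 opprK -natrD pnatr_eq0.
  by rewrite eqxx -subr_eq0 -opprD oppr_eq0 -natrD pnatr_eq0.
by case=> ->; rewrite // opp_c opprK.
Qed.

Lemma cheb_nodes p q : (0 < p)%N -> odd q -> exists ns : seq (C * C),
  [/\ uniq ns, size ns = (p.-1 * q.-1 %/ 2)%N & forall s, (s \in ns) =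
    [&& (U p).[s.1] == 0, (U q).[s.2] == 0 & (T p).[s.1] == (T q).[s.2]]].
Proof.
move=> p0 oq; have q0 : (0 < q)%N by case: q oq.
have [rs [urs srs mem_rs]] := chebU_roots p0.
have [rs' [urs' srs' mem_rs']] := chebU_roots q0.
pose f x := [seq y <- rs' | (T q).[y] == (T p).[x]].
exists [seq (x, y) | x <- rs, y <- f x]; split.
- apply: allpairs_uniq_dep => // [x _|[x y] [x' y'] _ _ [-> ->] //].
  exact: filter_uniq.
- rewrite size_allpairs_dep sumnE big_map (@eq_big_seq _ _ _ _ rs _ (fun=> q.-1./2)).
    (* As [q.-1] is even, the integer division by 2 commutes with the product by [p.-1]. *)
    by rewrite big_const_seq count_predT iter_addn_0 srs mulnC -divn2 muln_divA // -subn1 dvdn2 oddB // oq.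
  move=> x; rewrite mem_rs size_filter => /eqP /chebU_root_cheb.
  exact: count_chebU_roots.
- move=> [x y] /=; apply/allpairsPdep/and3P.
    move=> [x' [y' []]]; rewrite mem_rs mem_filter mem_rs' => ux /andP[e uy] [-> ->].
    by rewrite ux uy eq_sym.
  move=> [ux uy e]; exists x, y; split=> //; first by rewrite mem_rs.
  by rewrite mem_filter mem_rs' uy eq_sym e.
Qed.

(** * Recovering the parameter of the Chebyshev curve *)

Section Parametrization.
Context (p q m n : nat).
Hypotheses (p_gt0 : (0 < p)%N) (q_gt0 : (0 < q)%N) (bez : (m * p = n * q + 1)%N).

Definition recover_param x y W :=
  2^-1 * ((T m).[y] * (T n).[x] - (U m).[y] * (U n).[x] * W * (y ^+ 2 - 4)).

(** The hypothesis turns W U_p(t)^2 into U_p(t) U_q(t). After composition, with k = n q, the claim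
    is the addition formula C_{k+1} C_k - (t^2 - 4) U_{k+1} U_k = 2 t. *)
Lemma recover_param_eq t W : (U q).[t] = W * (U p).[t] ->
  recover_param (T q).[t] (T p).[t] W = t.
Proof.
move=> eW; rewrite /recover_param chebU_sqr !cheb_comp.
have -> : (U m).[(T p).[t]] * (U n).[(T q).[t]] * W *
    ((t ^+ 2 - 4) * (U p).[t] ^+ 2) =
    ((U m).[(T p).[t]] * (U p).[t]) * ((U n).[(T q).[t]] * (U q).[t]) * (t ^+ 2 - 4).
  by rewrite eW; ring.
rewrite !chebU_comp (mulnC p) (mulnC q) bez addn1; move: (n * q)%N => k.
have [z z0 ->] := exists_laurent t.
have -> : (z + z^-1) ^+ 2 - 4 = (z - z^-1) ^+ 2 by field.
rewrite expr2 [X in _ - X](_ : _ =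
   ((U k.+1).[z + z^-1] * (z - z^-1)) * ((U k).[z + z^-1] * (z - z^-1))); last by ring.
rewrite !chebU_laurent // !cheb_laurent // exprS.
have zk0 : z ^+ k != 0 by rewrite expf_neq0.
by field; apply/andP.
Qed.

Lemma common_root x y : x != 0 -> y != 0 -> x ^+ p = y ^+ q ->
  exists z, [/\ z != 0, z ^+ q = x & z ^+ p = y].
Proof.
(* By m p - n q = 1, z^q = x^(m p) / x^(n q) = x and z^p = y^(m p) / y^(n q) = y. *)
move=> x0 y0 e; exists (y ^+ m / x ^+ n).
have xk k : x ^+ k != 0 by rewrite expf_neq0.
have yk k : y ^+ k != 0 by rewrite expf_neq0.
split; first by rewrite mulf_neq0 ?invr_eq0.
- rewrite exprMn exprVn -!exprM mulnC exprM -e -exprM mulnC bez exprD expr1.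
  by field.
- rewrite exprMn exprVn -!exprM bez (mulnC n p) exprM e -exprM mulnC exprD expr1.
  by field.
Qed.

Lemma curve_param x y : (T p).[x] = (T q).[y] ->
  exists t, x = (T q).[t] /\ y = (T p).[t].
Proof.
have [a a0 ->] := exists_laurent x; have [b b0 ->] := exists_laurent y.
rewrite !cheb_laurent // => e.
(* Equality of the sums only says that a^p is b^q or its inverse; in the second case b is replaced
   by 1/b, which leaves y unchanged. *)
have [c [c0 ec eab]] : exists c, [/\ c != 0, b + b^-1 = c + c^-1 & a ^+ p = c ^+ q].
  have A0 : a ^+ p != 0 by rewrite expf_neq0.
  have B0 : b ^+ q != 0 by rewrite expf_neq0.
  have : (a ^+ p - b ^+ q) * (a ^+ p * b ^+ q - 1) == 0.
    rewrite -(mulrI_eq0 _ (lregP (mulf_neq0 (invr_neq0 A0) (invr_neq0 B0)))).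
    move/eqP: e; rewrite -subr_eq0; congr (_ == _); by field; apply/andP.
  rewrite mulf_eq0 !subr_eq0 => /orP[] /eqP eab; first by exists b.
  exists b^-1; rewrite invr_eq0 invrK exprVn; split=> //; first by rewrite addrC.
  by apply: (mulIf B0); rewrite eab mulVf.
have [z [z0 za zc]] := common_root a0 c0 eab.
by exists (z + z^-1); rewrite !cheb_laurent // za zc.
Qed.

Lemma node_param x y W : (U p).[x] = 0 -> (T p).[x] = (T q).[y] -> y ^+ 2 - 4 != 0 ->
  W ^+ 2 * (y ^+ 2 - 4) = x ^+ 2 - 4 ->
  exists t, [/\ x = (T q).[t], y = (T p).[t] & (U q).[t] = W * (U p).[t]].
Proof.
have [a a0 ->] := exists_laurent x; have [b b0 ->] := exists_laurent y.
have sq (c : C) : c != 0 -> (c + c^-1) ^+ 2 - 4 = (c - c^-1) ^+ 2 by move=> c0; field.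
rewrite !sq // expf_eq0 /= => Ux Txy b20 eW.
have eap : a ^+ p = a ^- p.
  by apply/eqP; rewrite -subr_eq0 -chebU_laurent // Ux mul0r.
have eab : a ^+ p = b ^+ q.
  have B0 : b ^+ q != 0 by rewrite expf_neq0.
  have A2 : a ^+ p * a ^+ p = 1 by rewrite {2}eap mulfV // expf_neq0.
  apply/esym/eqP; rewrite -subr_eq0 -sqrf_eq0; apply/eqP.
  move: Txy; rewrite !cheb_laurent // -eap => e.
  have -> : (b ^+ q - a ^+ p) ^+ 2 =
     b ^+ q * ((b ^+ q + b ^- q) - (a ^+ p + a ^+ p)) + (a ^+ p * a ^+ p - 1) by field.
  by rewrite -e A2 !subrr mulr0 addr0.
(* Only W^2 is prescribed, so a - 1/a is W (b - 1/b) up to sign. Passing from a to 1/a absorbs the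
   sign, harmlessly because a^p is its own inverse at a node. *)
have [c [c0 ec ecb ecW]] : exists c, [/\ c != 0, a + a^-1 = c + c^-1, c ^+ p = b ^+ q &
    c - c^-1 = W * (b - b^-1)].
  move/eqP: eW; rewrite -exprMn eqf_sqr => /orP[] /eqP eW; first by exists a.
  exists a^-1; rewrite invr_eq0 invrK exprVn -eap; split=> //; first by rewrite addrC.
  by rewrite eW opprB.
have [z [z0 zc zb]] := common_root c0 b0 ecb.
exists (z + z^-1); rewrite !cheb_laurent // zc zb; split=> //.
have zz : z - z^-1 != 0.
  apply: contraNneq b20 => zz.
  by rewrite -zb -chebU_laurent // zz mulr0.
by apply: (mulIf zz); rewrite -mulrA !chebU_laurent // zc zb.
Qed.

End Parametrization.
End Chebyshev.

Lemma chebU_separator (R : realType) k (x : R[i]) : (0 < k)%N ->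
  exists2 P : {poly R[i]}, P.[x] != 0 &
    forall t, (chebU k).[t] = 0 -> P.[t] != 0 -> t = x.
Proof.
move=> k0; have [rs [_ _ mem]] := chebU_roots (R := R) k0.
exists (\prod_(r <- rs | r != x) ('X - r%:P)).
  by rewrite -big_filter -/(root _ _) root_prod_XsubC mem_filter eqxx.
move=> t /eqP; rewrite -mem -big_filter -/(root _ _) root_prod_XsubC mem_filter => ->.
by rewrite andbT negbK => /eqP.
Qed.

(** * Rationally parametrized affine curves *)

Lemma mpoly_ring_ind n (A : nzRingType) (Q : {mpoly A[n]} -> Prop) :
  (forall c, Q c%:MP) -> (forall i, Q 'X_i) ->
  (forall f g, Q f -> Q g -> Q (f + g)) ->
  (forall f g, Q f -> Q g -> Q (f * g)) -> forall f, Q f.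
Proof.
move=> QC QX QD QM; apply: mpolyind => [|c m f _ _ Qf]; first by rewrite -mpolyC0.
apply: QD => //; rewrite -mul_mpolyC; apply: (QM) => //; rewrite mpolyXE_id.
apply: big_ind => [||i _]; [by rewrite -mpolyC1|exact: (QM)|].
elim: (m i) => [|k IHk]; first by rewrite expr0 -mpolyC1.
by rewrite exprS; exact: (QM).
Qed.

(** * Polynomial functions in arbitrarily many coordinates *)

Section Polyfun.
Context {R : realType} {I : Type}.
Local Notation C := (R[i]).
Implicit Types (f g : (I -> C) -> C).

Lemma polyfun_coord (i : I) : polyfun (fun x : I -> C => x i).
Proof.
by exists 1%N, (fun=> i), 'X_ord0 => x; rewrite mevalXU.
Qed.

Lemma polyfun_cst (c : C) : polyfun (fun _ : I -> C => c).
Proof.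
by exists 0%N, (fun k : 'I_0 => match k with Ordinal _ h => False_rect I (notF h) end),
  c%:MP => x; rewrite mevalC.
Qed.

(** The two functions may use different coordinates; concatenating their index lists puts them in
    one polynomial ring. *)
Lemma polyfun_pair f g : polyfun f -> polyfun g ->
  exists n (idx : 'I_n -> I) (P Q : {mpoly C[n]}), forall x,
    f x = P.@[fun k => x (idx k)] /\ g x = Q.@[fun k => x (idx k)].
Proof.
move=> [n1 [i1 [P1 e1]]] [n2 [i2 [P2 e2]]].
pose idx (k : 'I_(n1 + n2)) := match fintype.split k with inl a => i1 a | inr b => i2 b end.
exists (n1 + n2)%N, idx, (P1 \mPo [tuple 'X_(lshift n2 k) | k < n1]),
  (P2 \mPo [tuple 'X_(rshift n1 k) | k < n2]) => x.
rewrite e1 e2 !comp_mpoly_meval; split; apply: meval_eq => k;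
  rewrite tnth_mktuple mevalXU /idx.
  by rewrite -[lshift _ _]/(unsplit (inl k)) unsplitK.
by rewrite -[rshift _ _]/(unsplit (inr k)) unsplitK.
Qed.

Lemma polyfunD f g : polyfun f -> polyfun g -> polyfun (fun x => f x + g x).
Proof.
move=> /polyfun_pair pf /pf[n [idx [P [Q e]]]]; exists n, idx, (P + Q) => x.
by rewrite mevalD; have [-> ->] := e x.
Qed.

Lemma polyfunM f g : polyfun f -> polyfun g -> polyfun (fun x => f x * g x).
Proof.
move=> /polyfun_pair pf /pf[n [idx [P [Q e]]]]; exists n, idx, (P * Q) => x.
by rewrite mevalM; have [-> ->] := e x.
Qed.

Lemma polyfunN f : polyfun f -> polyfun (fun x => - f x).
Proof.
move=> [n [idx [P e]]]; exists n, idx, (- P) => x.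
by rewrite mevalN e.
Qed.

Lemma polyfunX f k : polyfun f -> polyfun (fun x => f x ^+ k).
Proof.
move=> [n [idx [P e]]]; exists n, idx, (P ^+ k) => x.
by rewrite rmorphXn /= e.
Qed.

Lemma polyfun_horner (P : {poly C}) f : polyfun f -> polyfun (fun x => P.[f x]).
Proof.
move=> pf; elim/poly_ind: P => [|P c IHP].
  by rewrite (_ : (fun _ => _) = fun=> 0); [exact: polyfun_cst|apply/funext => x; rewrite horner0].
rewrite (_ : (fun _ => _) = fun x => P.[f x] * f x + c).
  by apply: polyfunD; [exact: polyfunM|exact: polyfun_cst].
by apply/funext => x; rewrite hornerMXaddC.
Qed.

Lemma zclosed_zeros f : polyfun f -> zclosed [set x | f x = 0].
Proof.
move=> pf; exists [set f] => [g -> //|].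
by apply/seteqP; split=> x /=; [move=> fx g -> | apply].
Qed.

Lemma zclosed_bigcap (A : Type) (F : A -> (I -> C) -> C) :
  (forall a, polyfun (F a)) -> zclosed [set x | forall a, F a x = 0].
Proof.
move=> pF; exists (range F) => [g [a _ <-] //|].
by apply/seteqP; split=> x /= h; [move=> _ [a _ <-]|move=> a; apply: h; exists a].
Qed.

End Polyfun.

(** * Rational functions of one variable with their formal derivatives *)

Section RationalFunctions.
Context {R : realType}.
Local Notation C := (R[i]).
Implicit Types (S P Q : {poly C}) (h k : C -> C).

(* h agrees with a rational function, and h' with its derivative, at every point
   where S does not vanish. *)
Definition ratfun S h h' : Prop := exists P Q, forall t, S.[t] != 0 ->
  [/\ Q.[t] != 0, h t = P.[t] / Q.[t] &
    h' t = (P^`() * Q - P * Q^`()).[t] / Q.[t] ^+ 2].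

Lemma ratfun_ext S h h' k k' : (forall t, h t = k t) -> (forall t, h' t = k' t) ->
  ratfun S h h' -> ratfun S k k'.
Proof.
by move=> e e' [P [Q H]]; exists P, Q => t /H[]; rewrite e e'.
Qed.

Lemma ratfun_poly S P : ratfun S (fun t => P.[t]) (fun t => P^`().[t]).
Proof.
exists P, 1 => t _; rewrite hornerC oner_neq0 divr1 expr1n divr1.
by rewrite -polyC1 derivC mulr0 subr0 mulr1.
Qed.

Lemma ratfun_cst S c : ratfun S (fun=> c) (fun=> 0).
Proof.
apply: ratfun_ext (ratfun_poly S c%:P) => t; first by rewrite hornerC.
by rewrite derivC horner0.
Qed.

Lemma ratfunD S h h' k k' : ratfun S h h' -> ratfun S k k' ->
  ratfun S (fun t => h t + k t) (fun t => h' t + k' t).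
Proof.
move=> [P [Q H]] [P1 [Q1 K]]; exists (P * Q1 + P1 * Q), (Q * Q1) => t St.
have [Q0 -> ->] := H t St; have [Q10 -> ->] := K t St.
rewrite !(derivD, derivM, hornerD, hornerN, hornerM) mulf_neq0 //.
by split=> //; field; apply/andP.
Qed.

Lemma ratfunM S h h' k k' : ratfun S h h' -> ratfun S k k' ->
  ratfun S (fun t => h t * k t) (fun t => h' t * k t + h t * k' t).
Proof.
move=> [P [Q H]] [P1 [Q1 K]]; exists (P * P1), (Q * Q1) => t St.
have [Q0 -> ->] := H t St; have [Q10 -> ->] := K t St.
rewrite !(derivD, derivM, hornerD, hornerN, hornerM) mulf_neq0 //.
by split=> //; field; apply/andP.
Qed.

Lemma ratfun_div S P Q : (forall t, S.[t] != 0 -> Q.[t] != 0) ->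
  ratfun S (fun t => P.[t] / Q.[t])
    (fun t => (P^`() * Q - P * Q^`()).[t] / Q.[t] ^+ 2).
Proof. by move=> SQ; exists P, Q => t /SQ. Qed.

Lemma ratfun_meval S n (g g' : C -> 'I_n -> C) (P : {mpoly C[n]}) :
  (forall i, ratfun S (fun t => g t i) (fun t => g' t i)) ->
  ratfun S (fun t => P.@[g t]) (fun t => \sum_i (P^`M(i)).@[g t] * g' t i).
Proof.
move=> rg; elim/mpoly_ring_ind: P => [c|i|P Q IHP IHQ|P Q IHP IHQ].
- apply: ratfun_ext (ratfun_cst S c) => t; first by rewrite mevalC.
  by rewrite big1 // => i _; rewrite mderivC meval0 mul0r.
- apply: ratfun_ext (rg i) => t; first by rewrite mevalXU.
  rewrite (bigD1 i) //= big1 ?addr0 => [|j /negbTE ji].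
    rewrite mderivX mnm1E eqxx scale1r -[X in 'X_[X - _]]add0m addmK.
    by rewrite mpolyX0 meval1 mul1r.
  by rewrite mderivX mnm1E eq_sym ji scale0r meval0 mul0r.
- apply: ratfun_ext (ratfunD IHP IHQ) => t; first by rewrite mevalD.
  by rewrite -big_split; apply: eq_bigr => i _; rewrite mderivD mevalD mulrDl.
- apply: ratfun_ext (ratfunM IHP IHQ) => t; first by rewrite mevalM.
  rewrite mulr_suml mulr_sumr -big_split; apply: eq_bigr => i _ /=.
  by rewrite mderivM mevalD 2!mevalM; ring.
Qed.

(** The numerator vanishes off finitely many points, so it is the zero polynomial and the formal
    derivative vanishes with it. *)
Lemma ratfun_eq0 S h h' : S != 0 -> ratfun S h h' ->
  (forall t, S.[t] != 0 -> h t = 0) -> forall t, S.[t] != 0 -> h' t = 0.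
Proof.
move=> S0 [P [Q H]] h0 t St; have [_ _ ->] := H t St.
suff -> : P = 0 by rewrite derivC !mul0r subrr horner0 mul0r.
apply: (poly_nonroot S0) => u; apply: contraNeq => Su.
apply/eqP; have [Q0 e _] := H u Su; move/eqP: (h0 u Su).
by rewrite e mulf_eq0 invr_eq0 (negbTE Q0) orbF => /eqP.
Qed.

End RationalFunctions.

Section ParametrizedCurves.
Context {R : realType}.
Local Notation C := (R[i]).

(** Stronger than an injective rational parametrization: the inverse [tau] is a polynomial function
    on the ambient space. Only rationality of the coordinates of [g] matters here, so the derivative
    in [ratfun] is left existential. *)
Definition parametrization {I : Type} (K : set (I -> C)) (S : {poly C})
    (g : C -> I -> C) (tau : (I -> C) -> C) : Prop :=
  [/\ S != 0, forall i, exists h', ratfun S (fun t => g t i) h', polyfun tau,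
    forall t, S.[t] != 0 -> tau (g t) = t &
    K = g @` [set t | S.[t] != 0]].

Lemma zcomponents_irreducible (I : Type) (K : set (I -> C)) :
  zirreducible K -> zcomponents K = [set K].
Proof.
move=> iK; apply/seteqP; split=> L /=; last first.
  by move=> ->; split=> // L' _ KL L'K; apply/seteqP.
by case=> _ LK /(_ K iK LK (fun _ => id)) ->.
Qed.

Section OneCurve.
Context {I : Type} {K : set (I -> C)} {S : {poly C}} {g : C -> I -> C}.
Context {tau : (I -> C) -> C} (parK : parametrization K S g tau).
Implicit Types f : (I -> C) -> C.

(** Only finitely many coordinates enter [f], so its pull-back is a quotient P / Q with Q nonzero
    wherever S is; the numerator carries the zeros. *)
Lemma parametrization_pullback f : polyfun f ->
  exists P : {poly C}, forall t, S.[t] != 0 -> (f (g t) == 0) = (P.[t] == 0).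
Proof.
case: parK => _ rg _ _ _ [n [idx [F eF]]]; have [h' rh'] := choice rg.
have [|P [Q H]] := @ratfun_meval R S n (fun t i => g t (idx i)) (fun t i => h' (idx i) t) F.
  by [].
exists P => t St; have [Q0 e _] := H t St.
by rewrite eF e mulf_eq0 invr_eq0 (negbTE Q0) orbF.
Qed.

Lemma parametrization_dense f (N : {poly C}) : polyfun f -> N != 0 ->
  (forall t, S.[t] != 0 -> N.[t] != 0 -> f (g t) = 0) -> forall x, K x -> f x = 0.
Proof.
have [S0 _ _ _ ->] := parK.
move=> pf N0 fN0 _ [t St <-]; have [P eP] := parametrization_pullback pf.
apply/eqP; rewrite eP //; suff -> : P = 0 by rewrite horner0.
apply: (poly_nonroot (mulf_neq0 S0 N0)) => u; apply: contraNeq.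
rewrite hornerM mulf_eq0 negb_or => /andP[Su Nu].
by rewrite -eP // fN0.
Qed.

Lemma parametrization_nonroot (P : {poly C}) : P != 0 ->
  exists t, S.[t] != 0 /\ P.[t] != 0.
Proof.
have [S0 _ _ _ _] := parK.
move=> P0; apply/not_existsP => h; case/eqP: (mulf_neq0 S0 P0).
apply: poly_ext => t; rewrite horner0 hornerM; apply/eqP; rewrite mulf_eq0.
by have := h t; case: eqP => //= St; case: eqP => //= Pt []; split; exact/eqP.
Qed.

(** If [K] is not inside [Z1], some equation of [Z1] pulls back to a nonzero polynomial. Off its
    roots the curve lies in [Z2], hence everywhere by density. *)
Lemma parametrization_irreducible : zirreducible K.
Proof.
have [S0 _ _ _ defK] := parK.
split=> [|Z1 Z2 [E1 pE1 ->] [E2 pE2 ->] K12].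
  have [t [St _]] := parametrization_nonroot (oner_neq0 _).
  by exists (g t); rewrite defK; exists t.
have [|/existsNP[x /not_implyP[Kx /existsNP[f1 /not_implyP[Ef1 f1x]]]]] :=
  pselect (K `<=` [set x | forall f, E1 f -> f x = 0]); first by left.
right=> y Ky f2 Ef2.
have [P1 e1] := parametrization_pullback (pE1 _ Ef1).
have P10 : P1 != 0.
  apply: contra_notN f1x => /eqP P10; move: Kx; rewrite defK => -[t St <-].
  by apply/eqP; rewrite e1 // P10 horner0.
apply: (parametrization_dense (pE2 _ Ef2) P10) Ky => t St P1t.
have [|h|] := K12 (g t); [by rewrite defK; exists t| |by apply].
by move: P1t; rewrite -e1 // h ?eqxx.
Qed.

(** A point inside [K] is a chain of length one. In a chain of length two the middle term is a
    proper closed subset, on which [tau] takes finitely many values; irreducibility shrinks it to a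
    point, leaving no room below. *)
Lemma parametrization_zdim : zdim K 1.
Proof.
have [S0 _ ptau gK defK] := parK.
split=> [|[Z [iZ ltZ]]].
  have [t [St _]] := parametrization_nonroot (oner_neq0 _).
  exists (fun i => if i == 0%N then [set g t] else K); split.
  - case=> [|[|//]] _ /=; last first.
      split; first exact: parametrization_irreducible.
      exists setT; last by rewrite setIT.
      by exists set0 => [? []|]; apply/seteqP; split=> // ? _ ? [].
    split.
      split=> [|Z1 Z2 _ _ h]; first by exists (g t).
      by have [//|?|?] := h (g t); [left|right] => _ ->.
    exists [set x | tau x + (- t) = 0].
      by apply: zclosed_zeros; apply: polyfunD => //; exact: polyfun_cst.
    apply/seteqP; split=> x /=; first by move=> ->; rewrite gK ?subrr // defK; split=> //; exists t.
    by rewrite defK => -[[u Su <-]]; rewrite gK // => /eqP; rewrite subr_eq0 => /eqP ->.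
  - case=> [|//] _ /=; split; first by move=> _ ->; rewrite defK; exists t.
    move=> h; have [u [Su]] := parametrization_nonroot (negbT (polyXsubC_eq0 t)).
    rewrite hornerXsubC subr_eq0 => /eqP; apply.
    by rewrite -(gK u) // (h (g u)) ?gK // defK; exists u.
have [[_ [Y0 cY0 eY0]] [iZ1 [Y1 cY1 eY1]]] := (iZ 0%N isT, iZ 1%N isT).
have [_ [Y2 _ eY2]] := iZ 2%N isT.
have [sub01 nsub10] := ltZ 0%N isT; have [sub12 nsub21] := ltZ 1%N isT.
have [x Z0x] := (iZ 0%N isT).1.1.
have Z1K : Z 1%N `<=` K by rewrite eY1 => ? [].
have [y [Ky nZ1y]] : exists y, K y /\ ~ Z 1%N y.
  apply: contra_notP nsub21 => /forallNP h; rewrite eY2 => z [Kz _].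
  by apply: contrapT => nz; apply: (h z).
have [f pf [fZ1 fy]] : exists2 f, polyfun f & (forall z, Z 1%N z -> f z = 0) /\ f y <> 0.
  have [E pE eE] := cY1.
  move: nZ1y; rewrite eY1 => /not_andP[//|]; rewrite eE => /existsNP[f /not_implyP[Ef fy]].
  by exists f; [exact: pE|split=> // z [_]; apply].
have [P eP] := parametrization_pullback pf.
have P0 : P != 0.
  apply: contra_notN fy => /eqP P0; move: Ky; rewrite defK => -[t St <-].
  by apply/eqP; rewrite eP // P0 horner0.
have [rs def_P] := closed_field_poly_normal P.
have rsP t : P.[t] = 0 -> t \in rs.
  move/eqP; rewrite -/(root P t) def_P rootZ ?lead_coef_eq0 //.
  by rewrite root_prod_XsubC.
suff sing u v : Z 1%N u -> Z 1%N v -> u = v.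
  by apply: nsub10 => z Z1z; rewrite (sing z x) //; exact: sub01.
move=> Zu Zv.
(* [Z 1] is covered by the locus where [tau] equals [tau u] and the locus where it equals another
   root of [P]; the second misses u, so irreducibility selects the first. *)
pose G := \prod_(r <- rs | r != tau u) ('X - r%:P).
have [] := iZ1.2 [set z | tau z + - tau u = 0] [set z | G.[tau z] = 0].
- by apply: zclosed_zeros; apply: polyfunD => //; exact: polyfun_cst.
- by apply: zclosed_zeros; exact: polyfun_horner.
- move=> z Zz /=; have [->|tz] := eqVneq (tau z) (tau u); first by left; rewrite subrr.
  right; have := Z1K z Zz; rewrite defK => -[s Ss ez].
  have es : tau z = s by rewrite -ez gK.
  have srs : s \in rs by apply: rsP; apply/eqP; rewrite -eP // ez fZ1.
  apply/eqP; rewrite es -/(root _ _) /G -big_filter root_prod_XsubC.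
  by rewrite mem_filter srs -es tz.
- have [[s Ss eu] [r Sr ev]] : (exists2 s, S.[s] != 0 & g s = u) /\ (exists2 s, S.[s] != 0 & g s = v).
    by split; [have := Z1K u Zu|have := Z1K v Zv]; rewrite defK.
  move=> /(_ v Zv) /= /eqP; rewrite subr_eq0 -eu -ev !gK // => /eqP.
  by move=> ->.
- move=> /(_ u Zu) /= /eqP; rewrite -/(root _ _) /G -big_filter root_prod_XsubC.
  by rewrite mem_filter eqxx.
Qed.

End OneCurve.

(** The curve is a graph over [tau], cut out by the possibly infinitely many equations x_i = P_i(tau
    x). *)
Lemma parametrization_closed (I : Type) (K : set (I -> C)) g tau :
  parametrization K 1 g tau -> (forall i, exists P : {poly C}, forall t, g t i = P.[t]) ->
  zclosed K.
Proof.
move=> [_ _ ptau gK ->] pg; have [P eP] := choice pg.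
rewrite (_ : _ @` _ = [set x | forall i, x i + - (P i).[tau x] = 0]).
  apply: zclosed_bigcap => i; apply: polyfunD; first exact: polyfun_coord.
  by apply: polyfunN; exact: polyfun_horner.
apply/seteqP; split=> x /=.
  by move=> [t St <-] i; rewrite gK // eP subrr.
move=> h; exists (tau x); first by rewrite hornerC oner_neq0.
by apply/funext => i; apply/esym/eqP; rewrite eP -subr_eq0 h.
Qed.

Lemma parametrization_birational (I J : Type) (K : set (I -> C)) (L : set (J -> C))
    S g tau S' g' tau' :
  parametrization K S g tau -> parametrization L S' g' tau' -> birational K L.
Proof.
(* One half of the birational map: the points of [K'] whose parameter is also admissible for [L']
   form a dense open set, carried into [L'] by [f' \o t0]. By symmetry it serves in both
   directions. *)
have half (I' J' : Type) (K' : set (I' -> C)) (L' : set (J' -> C)) A f t0 A' f' t0' :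
    parametrization K' A f t0 -> parametrization L' A' f' t0' ->
    let V := f @` [set t | A.[t] != 0 /\ A'.[t] != 0] in
    let V' := f' @` [set t | A'.[t] != 0 /\ A.[t] != 0] in
    [/\ zopen_in K' V, zdense_in K' V & regular_map V V' (f' \o t0)].
  move=> pK pL; have [A0 rf pt fK defK] := pK; have [A'0 rf' _ _ _] := pL.
  split.
  - exists [set x | A'.[t0 x] = 0]; first by apply: zclosed_zeros; exact: polyfun_horner.
    rewrite defK; apply/seteqP; split=> x /=.
      by move=> [t [At A't] <-]; split; [exists t|rewrite fK //; exact/eqP].
    by move=> [[t At <-]]; rewrite fK // => /eqP A't; exists t.
  - split=> [x [t [At _] <-]|Z [E pE ->] VZ x Kx h Eh]; first by rewrite defK; exists t.
    apply: (parametrization_dense pK (pE _ Eh) A'0) Kx => t At A't.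
    by apply: VZ Eh; exists t.
  - split=> [_ [t [At A't] <-]|j _ [t [At A't] <-]] /=.
      by exists t => //; rewrite fK.
    have [h' [P [Q H]]] := rf' j.
    exists (fun x => P.[t0 x]), (fun x => Q.[t0 x]).
    split; [exact: polyfun_horner|exact: polyfun_horner| |].
      by rewrite fK //; have [] := H t A't.
    by move=> _ [u [Au A'u] <-] _ /=; rewrite !fK //; have [] := H u A'u.
move=> pK pL; have [oV dV rV] := half _ _ _ _ _ _ _ _ _ _ pK pL.
have [oV' dV' rV'] := half _ _ _ _ _ _ _ _ _ _ pL pK.
do 2 eexists; split; [split; [exact: oV|exact: dV]|split; [exact: oV'|exact: dV']|].
exists (g' \o tau), (g \o tau'); split=> //.
  by move=> _ [t [St S't] <-] /=; have [_ _ _ -> // _] := pK; have [_ _ _ -> // _] := pL.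
by move=> _ [t [St S't] <-] /=; have [_ _ _ -> // _] := pL; have [_ _ _ -> // _] := pK.
Qed.

End ParametrizedCurves.

(** * Irreducible components of finite unions *)

Section Components.
Context {R : realType}.
Local Notation C := (R[i]).

Lemma zclosedU (I : Type) (Z1 Z2 : set (I -> C)) :
  zclosed Z1 -> zclosed Z2 -> zclosed (Z1 `|` Z2).
Proof.
move=> [E1 pE1 ->] [E2 pE2 ->].
exists [set h | exists f g, [/\ E1 f, E2 g & h = fun x => f x * g x]].
  by move=> _ [f [g [/pE1 pf /pE2 pg ->]]]; exact: polyfunM.
apply/seteqP; split=> x /=.
  by case=> h _ [f [g [Ef Eg ->]]]; [rewrite (h f) // mul0r|rewrite (h g) // mulr0].
move=> h; have [|/existsNP[f /not_implyP[Ef fx]]] :=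
  pselect (forall f, E1 f -> f x = 0); [by left|right=> g Eg].
have /eqP := h _ (ex_intro _ f (ex_intro _ g (And3 Ef Eg erefl))).
by rewrite mulf_eq0 => /orP[] /eqP.
Qed.

Lemma zirreducible_bigcup (I : Type) (K : set (I -> C)) n (Z : nat -> set (I -> C)) :
  zirreducible K -> (forall j, (j < n)%N -> zclosed (Z j)) ->
  K `<=` \bigcup_(j in `I_n) Z j -> exists2 j, (j < n)%N & K `<=` Z j.
Proof.
move=> [[x Kx] irrK]; elim: n => [|n IHn] cZ KZ; first by have [] := KZ x Kx.
have cU : zclosed (\bigcup_(j in `I_n) Z j).
  elim: n {IHn KZ} cZ => [|n IHn] cZ.
    exists [set fun=> 1] => [_ ->|]; first exact: polyfun_cst.
    apply/seteqP; split=> y /=; first by case.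
    by move=> /(_ _ erefl)/eqP; rewrite oner_eq0.
  rewrite bigcup_mkord big_ord_recr /= -bigcup_mkord; apply: zclosedU; last exact: cZ.
  by apply: IHn => j jn; apply: cZ; exact: ltnW.
have [|KU|KZn] := irrK _ (Z n) cU (cZ n (ltnSn n)).
- by move: KZ; rewrite bigcup_mkord big_ord_recr /= -bigcup_mkord.
- have [j jn KZj] := IHn (fun j jn => cZ j (ltnW jn)) KU.
  by exists j => //; exact: ltnW.
- by exists n.
Qed.

Section FiniteUnion.
Context {I : Type} {A : set (I -> C)} {n : nat} {a : nat -> set (I -> C)}.
Hypotheses (irr_a : forall j, (j < n)%N -> zirreducible (a j))
  (closed_a : forall j, (j < n)%N -> zclosed (a j))
  (antichain_a : forall i j, (i < n)%N -> (j < n)%N -> a i `<=` a j -> i = j)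
  (defA : A = \bigcup_(j in `I_n) a j).

(** An irreducible subset of the union lies in a single [a j]; as there are no inclusions among
    them, the [a j] are exactly the maximal ones. *)
Lemma zcomponents_bigcup : zcomponents A = a @` `I_n.
Proof.
apply/seteqP; split=> K /=.
  move=> [irrK KA maxK].
  have [j jn Kj] := zirreducible_bigcup irrK closed_a (eq_ind _ (fun B => K `<=` B) KA _ defA).
  exists j => //; apply: maxK; rewrite ?defA //; [exact: irr_a|exact: bigcup_sup].
move=> [j jn <-]; split; [exact: irr_a|by rewrite defA; exact: bigcup_sup|].
move=> L irrL jL LA; apply/seteqP; split=> //.
have [i lin Li] := zirreducible_bigcup irrL closed_a (eq_ind _ (fun B => L `<=` B) LA _ defA).
by rewrite (antichain_a jn lin (subset_trans jL Li)).
Qed.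

End FiniteUnion.

Lemma birational_by_components_bigcup (I J : Type) (A : set (I -> C)) (B : set (J -> C))
    n (a : nat -> set (I -> C)) (b : nat -> set (J -> C)) :
  (forall j, (j < n)%N -> zirreducible (a j)) -> (forall j, (j < n)%N -> zclosed (a j)) ->
  (forall i j, (i < n)%N -> (j < n)%N -> a i `<=` a j -> i = j) ->
  A = \bigcup_(j in `I_n) a j ->
  (forall j, (j < n)%N -> zirreducible (b j)) -> (forall j, (j < n)%N -> zclosed (b j)) ->
  (forall i j, (i < n)%N -> (j < n)%N -> b i `<=` b j -> i = j) ->
  B = \bigcup_(j in `I_n) b j ->
  (forall j, (j < n)%N -> birational (a j) (b j)) ->
  birational_by_components A B.
Proof.
move=> ia ca aa eA ib cb ab eB bir.
(* The number of a component; 0 is a mere default for sets that are not components. *)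
pose idx K := xget 0%N [set j | (j < n)%N /\ a j = K].
have idxK j : (j < n)%N -> idx (a j) = j.
  move=> jn; rewrite /idx; case: xgetP => [i _ [lin e]|h].
    by apply: aa => //; rewrite e.
  by case: (h j).
exists (b \o idx); rewrite (zcomponents_bigcup ia ca aa eA) (zcomponents_bigcup ib cb ab eB).
split; last by move=> _ [j jn <-] /=; rewrite idxK //; exact: bir.
split.
- by move=> _ [j jn <-] /=; rewrite idxK //; exists j.
- move=> K L /[!inE] -[j jn <-] [i lin <-] /=; rewrite !idxK // => e.
  by rewrite (ab j i) // e.
- by move=> _ [j jn <-]; exists (a j); [exists j|rewrite /= idxK].
Qed.

End Components.

Lemma regular_on_polyfun (R : realType) (I : Type) (A : set (I -> R[i])) f :
  polyfun f -> regular_on A f.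
Proof.
move=> pf x _; exists f, (fun=> 1); split; [exact: pf|exact: polyfun_cst|exact: oner_neq0|].
by move=> y _ _; rewrite divr1.
Qed.

(** * The blow-up of the Chebyshev curve *)

Section MpolyEval.
Context {R : realType}.
Local Notation C := (R[i]).

Lemma meval_horner n (P : {poly C}) (F : {mpoly C[n]}) x :
  ((map_poly (@mpolyC n C) P).[F]).@[x] = P.[F.@[x]].
Proof.
elim/poly_ind: P => [|P c IHP]; first by rewrite rmorph0 !horner0 meval0.
rewrite rmorphD rmorphM /= map_polyX map_polyC /= !hornerMXaddC.
by rewrite mevalD mevalM mevalC IHP.
Qed.

Lemma mderiv_horner n (P : {poly C}) (F : {mpoly C[n]}) i :
  ((map_poly (@mpolyC n C) P).[F])^`M(i) =
  (map_poly (@mpolyC n C) P^`()).[F] * F^`M(i).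
Proof.
elim/poly_ind: P => [|P c IHP].
  by rewrite derivC rmorph0 !horner0 mderiv0 mul0r.
rewrite derivD derivC addr0 derivM derivX mulr1 !rmorphD !rmorphM /= map_polyX map_polyC /=.
rewrite hornerMXaddC mderivD mderivC addr0 mderivM IHP hornerD hornerMX.
ring.
Qed.

Lemma mderivXU n (i j : 'I_n) : ('X_i : {mpoly C[n]})^`M(j) = (i == j)%:R.
Proof.
rewrite mderivX mnm1E; have [->|_] := eqVneq; last by rewrite scale0r.
by rewrite scale1r -[X in 'X_[X - _]]add0m addmK mpolyX0.
Qed.

Lemma polyfun_meval (I : Type) n (P : {mpoly C[n]}) (u : 'I_n -> (I -> C) -> C) :
  (forall k, polyfun (u k)) -> polyfun (fun x => P.@[fun k => u k x]).
Proof.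
move=> pu; elim/mpoly_ring_ind: P => [c|i|P Q IHP IHQ|P Q IHP IHQ].
- by rewrite (_ : (fun _ => _) = fun=> c); [exact: polyfun_cst|apply/funext => x; rewrite mevalC].
- by rewrite (_ : (fun _ => _) = u i); [exact: pu|apply/funext => x; rewrite mevalXU].
- rewrite (_ : (fun _ => _) = fun x => P.@[fun k => u k x] + Q.@[fun k => u k x]).
    exact: polyfunD.
  by apply/funext => x; rewrite mevalD.
- rewrite (_ : (fun _ => _) = fun x => P.@[fun k => u k x] * Q.@[fun k => u k x]).
    exact: polyfunM.
  by apply/funext => x; rewrite mevalM.
Qed.

Lemma polyfun_meval2 (I : Type) n k (G : {mpoly {mpoly C[n]}[k]})
    (u : 'I_n -> (I -> C) -> C) (v : 'I_k -> (I -> C) -> C) :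
  (forall i, polyfun (u i)) -> (forall j, polyfun (v j)) ->
  polyfun (fun x => (map_mpoly (meval (fun i => u i x)) G).@[fun j => v j x]).
Proof.
move=> pu pv; elim/mpoly_ring_ind: G => [c|i|P Q IHP IHQ|P Q IHP IHQ].
- rewrite (_ : (fun _ => _) = fun x => c.@[fun i => u i x]); first exact: polyfun_meval.
  by apply/funext => x; rewrite map_mpolyC mevalC.
- rewrite (_ : (fun _ => _) = v i); first exact: pv.
  by apply/funext => x; rewrite map_mpolyX mevalXU.
- rewrite (_ : (fun _ => _) = fun x => (map_mpoly (meval (fun i => u i x)) P).@[fun j => v j x]
     + (map_mpoly (meval (fun i => u i x)) Q).@[fun j => v j x]).
    exact: polyfunD.
  by apply/funext => x; rewrite rmorphD mevalD.
- rewrite (_ : (fun _ => _) = fun x => (map_mpoly (meval (fun i => u i x)) P).@[fun j => v j x]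
     * (map_mpoly (meval (fun i => u i x)) Q).@[fun j => v j x]).
    exact: polyfunM.
  by apply/funext => x; rewrite rmorphM mevalM.
Qed.

Lemma polyfun_mpoly n (f : ('I_n -> C) -> C) : polyfun f ->
  exists F : {mpoly C[n]}, forall x, f x = F.@[x].
Proof.
move=> [k [idx [P e]]]; exists (P \mPo [tuple 'X_(idx j) | j < k]) => x.
rewrite e comp_mpoly_meval; apply: meval_eq => j.
by rewrite tnth_mktuple mevalXU.
Qed.

End MpolyEval.

(** * The affine chart of the blow-up *)

Section BlowupChart.
Context {R : realType}.
Local Notation C := (R[i]).
Implicit Types (x y w t c : C) (u : 'I_3 -> C).

Local Notation cX u := (u (lshift 1 (ord0 : 'I_2))).
Local Notation cY u := (u (lshift 1 (ord_max : 'I_2))).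
Local Notation cW u := (u (ord_max : 'I_3)).

Definition pt2 x y : 'I_2 -> C := fun i => [:: x; y]`_i.
Definition pt3 x y w : 'I_3 -> C := fun i => [:: x; y; w]`_i.

Lemma pt2_eta (s : 'I_2 -> C) : s = pt2 (s ord0) (s ord_max).
Proof.
by apply/funext => -[[|[|//]] lti] /=; congr (s _); exact: val_inj.
Qed.

Lemma pt3_eta u : u = pt3 (cX u) (cY u) (cW u).
Proof.
by apply/funext => -[[|[|[|//]]] lti] /=; congr (u _); exact: val_inj.
Qed.

Lemma chart1 u : (chart u).1 = pt2 (cX u) (cY u).
Proof. exact: pt2_eta. Qed.

Lemma mem_P1_affine w (z : 'rV[C]_2) :
  (z \in val (P1_affine w)) = (z 0 ord0 == w * z 0 ord_max).
Proof.
apply/vlineP/eqP => [[k ->]|e]; first by rewrite !mxE /= mulr1 mulrC.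
exists (z 0 ord_max); apply/rowP => -[[|[|//]] lti]; rewrite !mxE /=.
  by rewrite mulrC -e; congr (z 0 _); exact: val_inj.
by rewrite mulr1; congr (z 0 _); exact: val_inj.
Qed.

(* The exponent [d] may be any sufficiently large number: this lets homogenized
   summands share a common degree. *)
Lemma mpoly_homogenize (F : {mpoly C[3]}) : exists N, forall d, (N <= d)%N ->
  exists2 G : {mpoly {mpoly C[2]}[2]}, G \is d.-homog &
    forall (s z : 'I_2 -> C) w, z ord0 = w * z ord_max ->
      (map_mpoly (meval s) G).@[z] = z ord_max ^+ d * F.@[pt3 (s ord0) (s ord_max) w].
Proof.
have homX (i : 'I_2) k : ('X_i : {mpoly {mpoly C[2]}[2]}) ^+ k \is k.-homog.
  by rewrite -[k in _ \is k.-homog]mul1n; apply: dhomogMn; rewrite dhomogX /= mdeg1.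
elim/mpoly_ring_ind: F => [c|i|F1 F2 [N1 H1] [N2 H2]|F1 F2 [N1 H1] [N2 H2]].
- exists 0%N => d _; exists (c%:MP *: 'X_ord_max ^+ d); first by apply: dhomogZ; exact: homX.
  move=> s z w _; rewrite -mul_mpolyC rmorphM rmorphXn /= map_mpolyC map_mpolyX.
  by rewrite mevalM mevalC rmorphXn /= mevalXU !mevalC mulrC.
- have [i2|i2] := eqVneq (i : nat) 2%N.
    (* The third coordinate w stands for Z0 / Z1 and costs one degree: one factor Z1 is traded for
       Z0. *)
    exists 1%N => -[//|d] _; exists ('X_ord0 * 'X_ord_max ^+ d).
      by rewrite -[d.+1]add1n; apply: dhomogM; rewrite ?homX // -['X_ord0]expr1 homX.
    move=> s z w e; rewrite rmorphM rmorphXn /= !map_mpolyX mevalM rmorphXn /= !mevalXU.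
    by rewrite /pt3 i2 /= e exprS; ring.
  have lti : (i < 2)%N by case: i i2 => [[|[|[|?]]] ?].
  exists 0%N => d _; exists ('X_(Ordinal lti) *: 'X_ord_max ^+ d); first by apply: dhomogZ; exact: homX.
  move=> s z w _; rewrite -mul_mpolyC rmorphM rmorphXn /= map_mpolyC map_mpolyX.
  rewrite mevalM mevalC rmorphXn /= !mevalXU mulrC; congr (_ * _).
  rewrite [in LHS](pt2_eta s) /pt3 /pt2 /=.
  by case: i lti {i2} => [[|[|?]] ?].
- exists (maxn N1 N2) => d; rewrite geq_max => /andP[/H1[G1 h1 e1] /H2[G2 h2 e2]].
  exists (G1 + G2); first exact: dhomogD.
  by move=> s z w e; rewrite rmorphD /= 2!mevalD mulrDr; congr (_ + _); [exact: e1|exact: e2].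
- exists (N1 + N2)%N => d led.
  have [G1 h1 e1] := H1 N1 (leqnn _).
  have [|G2 h2 e2] := H2 (d - N1)%N; first by rewrite leq_subRL //; lia.
  exists (G1 * G2).
    by rewrite -[d](@subnKC N1); [exact: dhomogM|lia].
  move=> s z w e; rewrite rmorphM /= 2!mevalM -[in RHS](@subnKC N1 d); last by lia.
  rewrite exprD mulrACA; congr (_ * _); [exact: e1|exact: e2].
Qed.

End BlowupChart.

(** * The proper transform and the exceptional lines *)

Section ChebyshevBlowup.
Context {R : realType} {p q m n : nat}.
Local Notation C := (R[i]).
Local Notation T := (cheb R).
Local Notation U := (@chebU R).
Local Notation cX u := (u (lshift 1 (ord0 : 'I_2))).
Local Notation cY u := (u (lshift 1 (ord_max : 'I_2))).
Local Notation cW u := (u (ord_max : 'I_3)).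
Implicit Types (x y w t c : C) (u : 'I_3 -> C) (s : 'I_2 -> C).

Lemma meval_chebF s : (chebF R p q).@[s] = (T p).[s ord0] - (T q).[s ord_max].
Proof. by rewrite mevalB !meval_horner !mevalXU. Qed.

Lemma meval_chebFX s : (chebFX R p q).@[s] = p%:R * (U p).[s ord0].
Proof.
rewrite /chebFX mderivB !mderiv_horner !mderivXU /= mulr1 mulr0 subr0.
by rewrite meval_horner mevalXU deriv_cheb hornerZ.
Qed.

Lemma meval_chebFY s : (chebFY R p q).@[s] = - (q%:R * (U q).[s ord_max]).
Proof.
rewrite /chebFY mderivB !mderiv_horner !mderivXU /= mulr1 mulr0 sub0r mevalN.
by rewrite meval_horner mevalXU deriv_cheb hornerZ.
Qed.

Hypotheses (p_gt0 : (0 < p)%N) (q_gt0 : (0 < q)%N).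
Hypotheses (bez : (m * p = n * q + 1)%N) (co_pq : coprime p q).

Let p0 : p%:R != 0 :> C. Proof. by rewrite pnatr_eq0 -lt0n. Qed.
Let q0 : q%:R != 0 :> C. Proof. by rewrite pnatr_eq0 -lt0n. Qed.

Lemma cheb_singE s : cheb_sing R p q s <->
  [/\ (U p).[s ord0] = 0, (U q).[s ord_max] = 0 & (T p).[s ord0] = (T q).[s ord_max]].
Proof.
rewrite /cheb_sing /= meval_chebF meval_chebFX meval_chebFY.
split=> [[/eqP + /eqP + /eqP]|[-> -> ->]]; last by rewrite !mulr0 oppr0 subrr.
rewrite subr_eq0 oppr_eq0 !mulf_eq0 (negbTE p0) (negbTE q0) /=.
by move=> /eqP ? /eqP ? /eqP ?.
Qed.

Lemma cheb_blowup_chart u : cheb_blowup R p q (chart u) <->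
  p%:R * (U p).[cX u] * cW u = q%:R * (U q).[cY u].
Proof.
rewrite /cheb_blowup /= meval_chebFX meval_chebFY opprK.
split=> [/(_ (affine_vec (cW u)))|e z].
  by rewrite mem_P1_affine !mxE /= !mulr1; apply; rewrite eqxx.
by rewrite mem_P1_affine => /eqP ->; rewrite mulrA e.
Qed.

Lemma YcurveE u : Ycurve R p q u <->
  p%:R * (U p).[cX u] * cW u = q%:R * (U q).[cY u] /\ (T p).[cX u] = (T q).[cY u].
Proof.
rewrite /Ycurve /blowup_preimage /= cheb_blowup_chart /cheb_curve /= meval_chebF.
by split=> -[e]; [move/eqP; rewrite subr_eq0 => /eqP|move=> ->; rewrite subrr].
Qed.

Lemma exceptional_lineE s u : cheb_sing R p q s ->
  exceptional_line R p q s u <-> u = pt3 (s ord0) (s ord_max) (cW u).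
Proof.
move=> /cheb_singE[Us0 Us1 _]; rewrite /exceptional_line /blowup_preimage /= cheb_blowup_chart.
split=> [[_ us]|->]; first by rewrite {1}[u]pt3_eta -us.
by rewrite /pt3 /= Us0 Us1 !mulr0 mul0r; split=> //; rewrite [RHS]pt2_eta; exact: pt2_eta.
Qed.

Definition proper_param t : 'I_3 -> C :=
  pt3 (T q).[t] (T p).[t] ((q%:R *: U q).[t] / (p%:R *: U p).[t]).

Definition slope u : C := p%:R / q%:R * cW u.

Definition proper_coord u : C := recover_param m n (cX u) (cY u) (slope u).

Local Notation Dset := (proper_param @` [set t | (U p).[t] != 0]).

(** A form without denominators: U_p(t) = 0 would now force U_q(t) = 0, which is impossible for
    coprime p and q. *)
Lemma proper_paramP u : Dset u <->
  exists t, [/\ cX u = (T q).[t], cY u = (T p).[t] & (U q).[t] = slope u * (U p).[t]].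
Proof.
split=> [[t Upt <-]|[t [eX eY eW]]].
  exists t; split=> //; rewrite /slope /proper_param /pt3 /= !hornerZ.
  by field; apply/and3P.
have Upt : (U p).[t] != 0.
  apply/eqP => Upt; apply: (chebU_coprime co_pq p_gt0 Upt).
  by rewrite eW Upt mulr0.
exists t => //; rewrite [u]pt3_eta eX eY /proper_param; congr (pt3 _ _ _).
by rewrite !hornerZ eW /slope; field; apply/and3P.
Qed.

Lemma proper_paramK t : (U p).[t] != 0 -> proper_coord (proper_param t) = t.
Proof.
move=> Upt; apply: (recover_param_eq bez).
by rewrite /slope /proper_param /pt3 /= !hornerZ; field; apply/and3P.
Qed.

Lemma polyfun_slope : polyfun slope.
Proof. by apply: polyfunM; [exact: polyfun_cst|exact: polyfun_coord]. Qed.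

Lemma polyfun_proper_coord : polyfun proper_coord.
Proof.
rewrite /proper_coord /recover_param.
have pX := polyfun_coord (lshift 1 (ord0 : 'I_2)) : polyfun (fun u => cX u).
have pY := polyfun_coord (lshift 1 (ord_max : 'I_2)) : polyfun (fun u => cY u).
apply: polyfunM; first exact: polyfun_cst.
apply: polyfunD; first by apply: polyfunM; exact: polyfun_horner.
apply: polyfunN; apply: polyfunM; last first.
  by apply: polyfunD; [exact: polyfunX|exact: polyfun_cst].
by apply: polyfunM; [apply: polyfunM; exact: polyfun_horner|exact: polyfun_slope].
Qed.

Definition proper_param' t : 'I_3 -> C :=
  pt3 (T q)^`().[t] (T p)^`().[t]
    (((q%:R *: U q)^`() * (p%:R *: U p) - (q%:R *: U q) * (p%:R *: U p)^`()).[t] /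
      (p%:R *: U p).[t] ^+ 2).

Lemma ratfun_proper_param i :
  ratfun (U p) (fun t => proper_param t i) (fun t => proper_param' t i).
Proof.
case: i => -[|[|[|//]]] lti.
- exact: ratfun_poly.
- exact: ratfun_poly.
- by apply: ratfun_div => t Upt; rewrite hornerZ mulf_neq0.
Qed.

Lemma proper_parametrization :
  parametrization Dset (U p) proper_param proper_coord.
Proof.
split=> //; first exact: chebU_neq0.
- by move=> i; exists (fun t => proper_param' t i); exact: ratfun_proper_param.
- exact: polyfun_proper_coord.
- exact: proper_paramK.
Qed.

(** Substituting the recovered parameter eliminates t and leaves three polynomial equations in the
    coordinates, whence closedness. *)
Lemma proper_paramE u : Dset u <-> [/\ cX u - (T q).[proper_coord u] = 0,
  cY u - (T p).[proper_coord u] = 0 &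
  (U q).[proper_coord u] - slope u * (U p).[proper_coord u] = 0].
Proof.
rewrite proper_paramP; split=> [[t [eX eY eW]]|[/eqP eX /eqP eY /eqP eW]].
  rewrite /proper_coord eX eY (recover_param_eq bez eW) eW.
  by rewrite !subrr.
exists (proper_coord u); move: eX eY eW; rewrite !subr_eq0.
by move=> /eqP ? /eqP ? /eqP ?.
Qed.

Lemma zclosed_proper : zclosed Dset.
Proof.
rewrite (_ : Dset = [set u | forall k : 'I_3, [:: cX u - (T q).[proper_coord u];
  cY u - (T p).[proper_coord u];
  (U q).[proper_coord u] - slope u * (U p).[proper_coord u]]`_k = 0]).
  apply: zclosed_bigcap; have := polyfun_proper_coord => pc.
  case=> -[|[|[|//]]] lti /=.
  - by apply: polyfunD; [exact: polyfun_coord|apply: polyfunN; exact: polyfun_horner].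
  - by apply: polyfunD; [exact: polyfun_coord|apply: polyfunN; exact: polyfun_horner].
  - apply: polyfunD; first exact: polyfun_horner.
    by apply: polyfunN; apply: polyfunM; [exact: polyfun_slope|exact: polyfun_horner].
apply/seteqP; split=> u /=.
  by move=> /proper_paramE[? ? ?] [[|[|[|//]]] lti].
move=> h; apply/proper_paramE.
by split; [exact: (h (@Ordinal 3 0 isT))|exact: (h (@Ordinal 3 1 isT))|exact: (h (@Ordinal 3 2 isT))].
Qed.

Lemma chebU_param t :
  (U p).[(T q).[t]] * (U q).[t] = (U q).[(T p).[t]] * (U p).[t].
Proof. by rewrite !chebU_comp mulnC. Qed.

Lemma proper_sub_Y : Dset `<=` Ycurve R p q.
Proof.
move=> _ [t Upt <-]; apply/YcurveE; rewrite /proper_param /pt3 /= !cheb_comp (mulnC p).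
split=> //; rewrite !hornerZ.
have -> : p%:R * (U p).[(T q).[t]] * (q%:R * (U q).[t] / (p%:R * (U p).[t])) =
    q%:R / (U p).[t] * ((U p).[(T q).[t]] * (U q).[t]) by field; apply/andP.
by rewrite chebU_param; field.
Qed.

Lemma Y_smooth_sub_proper u : Ycurve R p q u ->
  ~ cheb_sing R p q (chart u).1 -> Dset u.
Proof.
move=> /YcurveE[e Tpq] ns; apply/proper_paramP.
have [t [eX eY]] := curve_param bez Tpq; exists t; split=> //.
have := chebU_param t; rewrite -eX -eY => e'.
(* If U_p(X) vanished, the blow-up equation would give U_q(Y) = 0 and the point would lie over a
   node. So U_p(X) can be cancelled in [chebU_param]. *)
have UX0 : (U p).[cX u] != 0.
  apply: contra_notN ns => /eqP UX0; apply/cheb_singE; rewrite chart1 /=; split=> //.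
  by apply/eqP; rewrite -(mulrI_eq0 _ (lregP q0)) -e UX0 mulr0 mul0r.
apply: (mulfI UX0); rewrite e'.
have -> : (U q).[cY u] = p%:R * (U p).[cX u] * cW u / q%:R by rewrite e; field.
by rewrite /slope; field.
Qed.

Lemma node_neq s : cheb_sing R p q s -> s ord_max ^+ 2 - 4 != 0.
Proof. by move=> /cheb_singE[_ Us _]; exact: chebU_root_neq Us. Qed.

Lemma proper_nodeP u : cheb_sing R p q (chart u).1 ->
  Dset u <-> slope u ^+ 2 * (cY u ^+ 2 - 4) = cX u ^+ 2 - 4.
Proof.
move=> sing; have Y0 : cY u ^+ 2 - 4 != 0 by have := node_neq sing; rewrite chart1.
have [UX UY TXY] : [/\ (U p).[cX u] = 0, (U q).[cY u] = 0 & (T p).[cX u] = (T q).[cY u]].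
  by have /cheb_singE := sing; rewrite chart1.
rewrite proper_paramP; split=> [[t [-> -> e]]|e].
  by rewrite !chebU_sqr e; ring.
exact: (node_param bez UX TXY Y0 e).
Qed.

(** The closure is taken in C^2 x P^1, the image in affine 3-space. One inclusion homogenizes the
    affine equations. For the other, a form vanishing over the smooth points vanishes at all but
    finitely many parameters, hence along the whole image. *)
Lemma DcurveE : Dcurve R p q = Dset.
Proof.
(* Only finitely many parameters t have C_q(t) among the roots of U_p; excluding them keeps the
   point off the nodes. *)
have comp_neq0 : U p \Po T q != 0.
  apply: contraTneq (chebU_neq0 (R := R) (k := q * p) _) => [e|]; last by rewrite muln_gt0 q_gt0.
  rewrite negbK; apply/eqP/poly_ext => t.
  by rewrite -chebU_comp -horner_comp e !horner0 mul0r.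
apply/seteqP; split=> u.
  move=> [bu cu]; have [E pE defE] := zclosed_proper; rewrite defE => f Ef.
  have [F eF] := polyfun_mpoly (pE _ Ef).
  have [N /(_ N (leqnn _))[G homG eG]] := mpoly_homogenize F.
  (* The extra factor Z1 makes the form vanish at [1 : 0] too, where the affine equation gives no
     information. *)
  have homGX : G * 'X_ord_max \is (N + 1).-homog.
    by apply: dhomogM => //; rewrite dhomogX /= mdeg1.
  have /cu : forall Q, blowup_preimage R p q (cheb_curve R p q `\` cheb_sing R p q) Q ->
      vanishes_at (G * 'X_ord_max) Q.
    move=> [s L] [bQ [curveQ singQ]] z zL; rewrite /= in singQ curveQ *.
    rewrite rmorphM /= map_mpolyX mevalM mevalXU.
    have [->|z1] := eqVneq (z 0 ord_max) 0; first by rewrite mulr0.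
    pose w := z 0 ord0 / z 0 ord_max.
    rewrite (eG _ _ w); last by rewrite /w divfK.
    suff DQ : Dset (pt3 (s ord0) (s ord_max) w).
      by rewrite -eF (_ : f _ = 0) ?mulr0 ?mul0r //; move: DQ; rewrite defE; apply.
    apply: Y_smooth_sub_proper; last by rewrite chart1 /= -pt2_eta.
    apply/YcurveE; rewrite /pt3 /=; split.
      have := bQ z zL; rewrite /= meval_chebFX meval_chebFY opprK => e.
      by apply: (mulIf z1); rewrite -e /w; field.
    by apply/eqP; rewrite -subr_eq0 -meval_chebF; apply/eqP.
  move=> /(_ _ homGX (affine_vec (cW u))); rewrite mem_P1_affine !mxE /= mulr1 eqxx => /(_ isT).
  rewrite rmorphM /= map_mpolyX mevalM mevalXU (eG _ _ (cW u)) !mxE /= ?mulr1 //.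
  by rewrite expr1n mul1r -pt3_eta -eF.
move=> Du; have [bu _] := proper_sub_Y Du; split=> // d f _ fS z.
rewrite mem_P1_affine => /eqP ez.
(* A vector of the line [w : 1] is c (w, 1). With c frozen, the value of [f] there is a polynomial
   function of the point of 3-space, so density along the curve applies. *)
pose c := z 0 ord_max.
have -> : (fun j => z 0 j) = pt2 (cW u * c) c.
  by rewrite [LHS]pt2_eta ez.
pose a (i : 'I_2) (v : 'I_3 -> C) := v (lshift 1 i).
pose b (j : 'I_2) (v : 'I_3 -> C) := if j == ord0 then cW v * c else c.
have bE v : pt2 (cW v * c) c = b^~ v by apply/funext => -[[|[|//]] lti].
pose h v := (map_mpoly (meval (a^~ v)) f).@[b^~ v].
rewrite -[LHS]/(((map_mpoly (meval (a^~ u)) f).@[pt2 (cW u * c) c])) bE -/(h u).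
apply: (parametrization_dense proper_parametrization _ comp_neq0 _ Du).
  apply: polyfun_meval2 => [i|j]; first exact: polyfun_coord.
  rewrite /b; case: (j == ord0); last exact: polyfun_cst.
  by apply: polyfunM; [exact: polyfun_coord|exact: polyfun_cst].
move=> t Upt; rewrite horner_comp => Ut.
have Dt : Dset (proper_param t) by exists t.
have /fS : blowup_preimage R p q (cheb_curve R p q `\` cheb_sing R p q) (chart (proper_param t)).
  have [bt ct] := proper_sub_Y Dt; split=> //; split=> //= /cheb_singE[].
  by rewrite /proper_param /pt3 /= => /eqP; rewrite (negbTE Ut).
move=> /(_ (c *: affine_vec (cW (proper_param t)))).
rewrite mem_P1_affine !mxE /= mulr1 mulrC eqxx => /(_ isT).
rewrite (_ : (fun j => _) = b^~ (proper_param t)) //.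
by apply/funext => j; rewrite !mxE /b; case: (j == ord0); rewrite ?mulr1 // mulrC.
Qed.

(** The velocity of the parametrization spans the tangent space. It is tangent because an equation
    of the curve has zero derivative along it. Conversely, a tangent vector v satisfies the
    linearized identities expressing the coordinates through [proper_coord], so it is the velocity
    times d, the differential of [proper_coord] at v. *)
Lemma proper_nonsingular : nonsingular_curve (Dset : set ('I_3 -> C)).
Proof.
split=> [|_ [t Upt <-]].
  split; first exact: zclosed_proper.
    by have [] := parametrization_irreducible proper_parametrization.
  move=> K; rewrite zcomponents_irreducible; last exact: parametrization_irreducible proper_parametrization.
  by move=> ->; exact: parametrization_zdim proper_parametrization.
pose v0 : 'rV[C]_3 := \row_i proper_param' t i.
(* The Y-component of the velocity is p U_p(t), which is nonzero on the curve. *)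
have v01 : v0 0 (inord 1) != 0.
  by rewrite mxE /proper_param' /pt3 inordK //= deriv_cheb hornerZ mulf_neq0.
exists <[v0]>%VS.
  rewrite dim_vline; apply/eqP; rewrite eqb1; apply: contraNneq v01 => ->.
  by rewrite mxE.
apply/seteqP; split=> v /=; last first.
  move=> /vlineP[k ->] f fD.
  have h : \sum_i (f^`M(i)).@[proper_param t] * proper_param' t i = 0.
    apply: (ratfun_eq0 (chebU_neq0 p_gt0) (ratfun_meval f ratfun_proper_param) _ Upt).
    by move=> u Upu; apply: fD; exists u.
  transitivity (k * \sum_i (f^`M(i)).@[proper_param t] * proper_param' t i); last by rewrite h mulr0.
  by rewrite mulr_sumr; apply: eq_bigr => i _; rewrite !mxE; ring.
have [F eF] := polyfun_mpoly polyfun_proper_coord.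
have FK y : (U p).[y] != 0 -> F.@[proper_param y] = y by move=> Uu; rewrite -eF proper_paramK.
move=> tv; pose d := \sum_i (F^`M(i)).@[proper_param t] * v 0 i.
have chain (P : {poly C}) : \sum_i (((map_poly (@mpolyC 3 C) P).[F])^`M(i)).@[proper_param t] * v 0 i =
    P^`().[t] * d.
  rewrite /d mulr_sumr; apply: eq_bigr => i _.
  by rewrite mderiv_horner mevalM meval_horner FK // mulrA.
have coordE (j : 'I_3) : \sum_i (('X_j : {mpoly C[3]})^`M(i)).@[proper_param t] * v 0 i = v 0 j.
  rewrite (bigD1 j) //= mderivXU eqxx meval1 mul1r big1 ?addr0 // => i /negbTE ij.
  by rewrite mderivXU eq_sym ij meval0 mul0r.
pose ev (f : {mpoly C[3]}) := \sum_i (f^`M(i)).@[proper_param t] * v 0 i.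
have evB f g : ev (f - g) = ev f - ev g.
  by rewrite /ev -sumrB; apply: eq_bigr => i _; rewrite mderivB mevalB mulrBl.
have evM f g : ev (f * g) = ev f * g.@[proper_param t] + f.@[proper_param t] * ev g.
  rewrite /ev mulr_suml mulr_sumr -big_split; apply: eq_bigr => i _ /=.
  by rewrite mderivM mevalD 2!mevalM; ring.
have evX j : ev 'X_j = v 0 j by exact: coordE.
have evh P : ev (map_poly (@mpolyC 3 C) P).[F] = P^`().[t] * d by exact: chain.
have vX : v 0 (inord 0) = (T q)^`().[t] * d.
  apply/eqP; rewrite -subr_eq0 -evh -evX -evB; apply/eqP/tv => _ [u Uu <-].
  by rewrite mevalB mevalXU meval_horner FK // /proper_param /pt3 inordK //= subrr.
have vY : v 0 (inord 1) = (T p)^`().[t] * d.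
  apply/eqP; rewrite -subr_eq0 -evh -evX -evB; apply/eqP/tv => _ [u Uu <-].
  by rewrite mevalB mevalXU meval_horner FK // /proper_param /pt3 inordK //= subrr.
(* The third coordinate is a quotient, so its identity is linearized in the cleared form w p U_p = q
   U_q, both sides taken at the recovered parameter. *)
have vW : v 0 (inord 2) * (p%:R *: U p).[t] +
    (q%:R *: U q).[t] / (p%:R *: U p).[t] * ((p%:R *: U p)^`().[t] * d) = (q%:R *: U q)^`().[t] * d.
  have pUp y : (U p).[y] != 0 -> (p%:R *: U p).[y] != 0 by move=> Uu; rewrite hornerZ mulf_neq0.
  have := evM 'X_(inord 2) (map_poly (@mpolyC 3 C) (p%:R *: U p)).[F].
  rewrite evX evh mevalXU meval_horner FK // /proper_param /pt3 inordK //= => <-.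
  apply/eqP; rewrite -subr_eq0 -evh -evB; apply/eqP/tv => _ [u Uu <-].
  rewrite mevalB mevalM mevalXU !meval_horner FK // /proper_param /pt3 inordK //=.
  by rewrite divfK ?subrr // pUp.
have pUt : (p%:R *: U p).[t] != 0 by rewrite hornerZ mulf_neq0.
apply/vlineP; exists d; apply/rowP => i; rewrite !mxE /proper_param' /pt3.
case: i => -[|[|[|//]]] lti /=.
- by rewrite mulrC -vX; congr (v 0 _); apply: val_inj; rewrite /= inordK.
- by rewrite mulrC -vY; congr (v 0 _); apply: val_inj; rewrite /= inordK.
- rewrite (_ : Ordinal lti = inord 2); last by apply: val_inj; rewrite /= inordK.
  apply: (mulIf pUt); move/eqP: vW; rewrite -subr_eq0 => /eqP vW; rewrite -[LHS]subr0 -vW.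
  by rewrite !(hornerD, hornerN, hornerM); field.
Qed.

Lemma Y_decomposition :
  Ycurve R p q = Dset `|` \bigcup_(s in cheb_sing R p q) exceptional_line R p q s.
Proof.
apply/seteqP; split=> u; last first.
  move=> [|[s sings [bu us]]]; first exact: proper_sub_Y.
  by split=> //; have [Fs _ _] := sings; rewrite -(us : (chart u).1 = s) in Fs.
move=> Yu; have [su|su] := pselect (cheb_sing R p q (chart u).1).
  by right; exists (chart u).1 => //; split=> //; case: Yu.
by left; exact: Y_smooth_sub_proper.
Qed.

Lemma exceptional_line_image s : cheb_sing R p q s ->
  exceptional_line R p q s = pt3 (s ord0) (s ord_max) @` [set t | (1 : {poly C}).[t] != 0].
Proof.
move=> sings; apply/seteqP; split=> u.
  move/(exceptional_lineE _ sings) ->.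
  by exists (cW u) => //=; rewrite hornerC oner_neq0.
by move=> [w _ <-]; apply/(exceptional_lineE _ sings).
Qed.

Lemma exceptional_parametrization s : cheb_sing R p q s ->
  parametrization (exceptional_line R p q s) 1 (pt3 (s ord0) (s ord_max)) (fun u => cW u).
Proof.
move=> sings; split=> //; [exact: oner_neq0| |exact: polyfun_coord|exact: exceptional_line_image].
case=> -[|[|[|//]]] lti.
- by exists (fun=> 0); exact: ratfun_cst.
- by exists (fun=> 0); exact: ratfun_cst.
- exists (fun t => ('X : {poly C})^`().[t]); apply: ratfun_ext (ratfun_poly _ 'X) => t //.
  by rewrite hornerX.
Qed.

Lemma zclosed_exceptional s : cheb_sing R p q s -> zclosed (exceptional_line R p q s).
Proof.
move=> sings; apply: parametrization_closed (exceptional_parametrization sings) _.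
case=> -[|[|[|//]]] lti.
- by exists (s ord0)%:P => t; rewrite hornerC.
- by exists (s ord_max)%:P => t; rewrite hornerC.
- by exists 'X => t; rewrite hornerX.
Qed.

Lemma exceptional_affine s : cheb_sing R p q s -> affine_line (exceptional_line R p q s).
Proof.
move=> sings; exists (pt3 (s ord0) (s ord_max) 0), (pt3 0 0 1); split.
  by exists ord_max; exact: oner_neq0.
rewrite exceptional_line_image //; apply/seteqP; split=> u /=.
  by move=> [w _ <-]; exists w; case=> -[|[|[|//]]] lti; rewrite /pt3 /= ?mulr0 ?addr0 ?mulr1 ?add0r.
move=> [w ew]; exists w; first by rewrite hornerC oner_neq0.
apply/funext => i; rewrite ew.
by case: i => -[|[|[|//]]] lti; rewrite /pt3 /= ?mulr0 ?addr0 ?mulr1 ?add0r.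
Qed.

Lemma exceptional_line_inj s s' : cheb_sing R p q s -> cheb_sing R p q s' ->
  exceptional_line R p q s `<=` exceptional_line R p q s' -> s = s'.
Proof.
move=> ss ss' /(_ (pt3 (s ord0) (s ord_max) 0)) [].
  exact/(exceptional_lineE _ ss).
by move=> _ us; rewrite -(us : (chart _).1 = s') chart1 [LHS]pt2_eta.
Qed.

(** X is constant on an exceptional line, whereas it is the nonconstant C_q(t) along the proper
    transform. *)
Lemma proper_not_sub_exceptional s : ~ (Dset `<=` exceptional_line R p q s).
Proof.
move=> h.
have N0 : T q - (s ord0)%:P != 0.
  by rewrite -size_poly_gt0 size_polyDl size_cheb // size_polyN size_polyC ltnS (leq_trans (leq_b1 _)).
have [t [Upt]] := parametrization_nonroot proper_parametrization N0.
have [_ /= e] := h (proper_param t) (ex_intro2 _ _ t Upt erefl).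
by rewrite hornerD hornerN hornerC -e /= subrr eqxx.
Qed.

(** Membership in D fixes the square of the slope over a node, so w = 0 and w = 1 cannot both
    qualify. *)
Lemma exceptional_not_sub_proper s : cheb_sing R p q s ->
  ~ (exceptional_line R p q s `<=` Dset).
Proof.
move=> sings h.
have line w : Dset (pt3 (s ord0) (s ord_max) w).
  by apply: h; apply/(exceptional_lineE _ sings).
have eqw w : slope (pt3 0 0 w) ^+ 2 * (s ord_max ^+ 2 - 4) = s ord0 ^+ 2 - 4.
  by have /proper_nodeP := line w; apply; rewrite chart1 /= -pt2_eta.
have := eqw 0; rewrite -(eqw 1) /slope /pt3 /= mulr0 mulr1 expr0n mul0r => /esym/eqP.
by rewrite mulf_eq0 (negbTE (node_neq sings)) orbF expf_eq0 /= mulf_eq0 invr_eq0 (negbTE p0) (negbTE q0).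
Qed.

End ChebyshevBlowup.

Arguments slope {R} p q u.

(** * Two-by-two matrices and representations of presented groups *)

Section TwoByTwo.
Context {K : comNzRingType}.
Implicit Types (a b c d : K) (A B : 'M[K]_2).

Definition mx2 a b c d : 'M[K]_2 :=
  \matrix_(i, j) (nth [::] [:: [:: a; b]; [:: c; d]] i)`_j.

Definition cv2 a b : 'cV[K]_2 := \col_i [:: a; b]`_i.

Lemma mx2P A : exists a b c d, A = mx2 a b c d.
Proof.
exists (A 0 0), (A 0 1), (A 1 0), (A 1 1); apply/matrixP => i j; rewrite mxE.
by case: i j => -[|[|//]] lti [[|[|//]] ltj] /=; congr (A _ _); exact: val_inj.
Qed.

Lemma cv2P (v : 'cV[K]_2) : exists a b, v = cv2 a b.
Proof.
exists (v 0 0), (v 1 0); apply/matrixP => i j; rewrite mxE ord1.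
by case: i => -[|[|//]] lti /=; congr (v _ _); exact: val_inj.
Qed.

Lemma eq_mx2 a b c d a' b' c' d' :
  mx2 a b c d = mx2 a' b' c' d' <-> [/\ a = a', b = b', c = c' & d = d'].
Proof.
split=> [/matrixP e|[-> -> -> ->] //].
have := e 0 0; have := e 0 1; have := e 1 0; have := e 1 1.
by rewrite !mxE.
Qed.

Lemma eq_cv2 a b a' b' : cv2 a b = cv2 a' b' <-> a = a' /\ b = b'.
Proof.
split=> [/matrixP e|[-> ->] //].
by have := e 0 0; have := e 1 0; rewrite !mxE.
Qed.

Lemma mul_mx2 a b c d a' b' c' d' : mx2 a b c d *m mx2 a' b' c' d' =
  mx2 (a * a' + b * c') (a * b' + b * d') (c * a' + d * c') (c * b' + d * d').
Proof.
apply/matrixP => i j; rewrite !mxE !big_ord_recl big_ord0 !mxE /= addr0.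
by case: i j => -[|[|//]] lti [[|[|//]] ltj].
Qed.

Lemma mul_mx2_cv2 a b c d x y : mx2 a b c d *m cv2 x y = cv2 (a * x + b * y) (c * x + d * y).
Proof.
apply/matrixP => i j; rewrite !mxE !big_ord_recl big_ord0 !mxE /= addr0.
by case: i => -[|[|//]] lti.
Qed.

Lemma add_mx2 a b c d a' b' c' d' :
  mx2 a b c d + mx2 a' b' c' d' = mx2 (a + a') (b + b') (c + c') (d + d').
Proof.
by apply/matrixP => i j; rewrite !mxE; case: i j => -[|[|//]] lti [[|[|//]] ltj].
Qed.

Lemma scale_mx2 k a b c d : k *: mx2 a b c d = mx2 (k * a) (k * b) (k * c) (k * d).
Proof.
by apply/matrixP => i j; rewrite !mxE; case: i j => -[|[|//]] lti [[|[|//]] ltj].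
Qed.

Lemma opp_mx2 a b c d : - mx2 a b c d = mx2 (- a) (- b) (- c) (- d).
Proof.
by apply/matrixP => i j; rewrite !mxE; case: i j => -[|[|//]] lti [[|[|//]] ltj].
Qed.

Lemma scale_cv2 k a b : k *: cv2 a b = cv2 (k * a) (k * b).
Proof. by apply/matrixP => i j; rewrite !mxE; case: i => -[|[|//]] lti. Qed.

Lemma add_cv2 a b a' b' : cv2 a b + cv2 a' b' = cv2 (a + a') (b + b').
Proof. by apply/matrixP => i j; rewrite !mxE; case: i => -[|[|//]] lti. Qed.

Lemma scalar_mx2 k : k%:M = mx2 k 0 0 k.
Proof.
by apply/matrixP => i j; rewrite !mxE; case: i j => -[|[|//]] lti [[|[|//]] ltj].
Qed.

Lemma cv2_0 : 0 = cv2 0 0.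
Proof. by apply/matrixP => i j; rewrite !mxE; case: i => -[|[|//]] lti. Qed.

Lemma tr_mx2 a b c d : \tr (mx2 a b c d) = a + d.
Proof. by rewrite /mxtrace !big_ord_recl big_ord0 !mxE /= addr0. Qed.

Lemma det_mx2 a b c d : \det (mx2 a b c d) = a * d - b * c.
Proof.
rewrite (expand_det_row _ 0) !big_ord_recl big_ord0 /cofactor !det_mx11 !mxE /=.
by rewrite !expr0 expr1 mul1r addr0 mulN1r mulrN.
Qed.

Definition mx2E := (mul_mx2, mul_mx2_cv2, add_mx2, opp_mx2, scale_mx2, add_cv2, scale_cv2, tr_mx2, det_mx2).

Lemma sqr_mx2 A : \det A = 1 -> A *m A = \tr A *: A + (-1)%:M.
Proof.
have [a [b [c [d ->]]]] := mx2P A; rewrite scalar_mx2 !mx2E => e; apply/eq_mx2.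
by split; rewrite -?e; ring.
Qed.

End TwoByTwo.

Lemma map_mx2 (K L : comNzRingType) (f : {rmorphism K -> L}) (a b c d : K) :
  map_mx f (mx2 a b c d) = mx2 (f a) (f b) (f c) (f d).
Proof.
by apply/matrixP => i j; rewrite !mxE; case: i j => -[|[|//]] lti [[|[|//]] ltj].
Qed.

Section SL2Matrices.
Context {R : realType}.
Local Notation C := (R[i]).
Local Notation T := (cheb R).
Local Notation U := (@chebU R).
Implicit Types (A M : 'M[C]_2) (v : 'cV[C]_2) (c : C).

(** Iterated Cayley-Hamilton: powers of [A] obey the recurrence of the U_k. *)
Lemma exp_mx2 A k : \det A = 1 -> A ^+ k.+1 = (U k.+1).[\tr A] *: A - (U k).[\tr A]%:M.
Proof.
move=> A1; elim/nat_ind2: k => [||k IH0 IH1].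
- by rewrite /= horner0 hornerC scale1r raddf0 subr0 expr1.
- rewrite expr2 -[A * A]/(A *m A) sqr_mx2 // chebUSS hornerD hornerN hornerM hornerX /=.
  by rewrite hornerC horner0 mulr1 subr0 raddfN.
- rewrite exprS IH1 -[A * _]/(A *m _) mulmxBr -scalemxAr sqr_mx2 //.
  have eU : (U k.+3).[\tr A] = \tr A * (U k.+2).[\tr A] - (U k.+1).[\tr A].
    by rewrite (chebUSS k.+1) hornerD hornerN hornerM hornerX.
  rewrite mul_mx_scalar eU.
  move: (\tr A) (U k.+2).[_] (U k.+1).[_] {eU} => t x y.
  have [a [b [c [d ->]]]] := mx2P A; rewrite !scalar_mx2 !mx2E.
  by apply/eq_mx2; split; ring.
Qed.

Lemma tr_exp_mx2 A k : \det A = 1 -> \tr (A ^+ k) = (T k).[\tr A].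
Proof.
move=> A1; elim/nat_ind2: k => [||k IH0 IH1].
- by rewrite expr0 mxtrace1 /= hornerC.
- by rewrite expr1 /= hornerX.
- rewrite chebSS hornerD hornerN hornerM hornerX -IH0 -IH1.
  have sqA : A * A = \tr A *: A - 1 by rewrite -[A * A]/(A *m A) sqr_mx2 // raddfN.
  rewrite 2!(exprS A) mulrA sqA mulrBl mul1r -scalerAl -exprS raddfB /=.
  by rewrite mxtraceZ.
Qed.

Lemma det0_kernel M : \det M = 0 -> exists2 v : 'cV[C]_2, v != 0 & M *m v = 0.
Proof.
rewrite -det_tr => /eqP/det0P[w w0 wM]; exists w^T; first by rewrite trmx_eq0.
by rewrite -[M]trmxK -trmx_mul wM trmx0.
Qed.

Lemma eigenvector_exists A c : c != 0 -> \det A = 1 -> \tr A = c + c^-1 ->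
  exists2 v : 'cV[C]_2, v != 0 & A *m v = c *: v.
Proof.
move=> c0 detA trA; have [|v v0 Av] := @det0_kernel (A - c%:M).
  move: detA trA; have [a [b [d [e ->]]]] := mx2P A.
  rewrite scalar_mx2 !mx2E => detA trA.
  have -> : (a - c) * (e - c) - (b - 0) * (d - 0)
    = (a * e - b * d) - c * (a + e) + c ^+ 2 by ring.
  by rewrite detA trA; field.
exists v => //; apply/eqP; rewrite -subr_eq0 -mul_scalar_mx -mulmxBl.
exact/eqP.
Qed.

Lemma eigenvalue_tr A c v : \det A = 1 -> v != 0 -> A *m v = c *: v ->
  c != 0 /\ \tr A = c + c^-1.
Proof.
move=> detA v0 Av.
have : \det (A - c%:M) = 0.
  apply/eqP/contraT => d0; case/eqP: v0.
  have unitM : A - c%:M \in unitmx by rewrite unitmxE unitfE.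
  by rewrite -[v](mulKmx unitM) mulmxBl Av mul_scalar_mx subrr mulmx0.
move: detA; have [a [b [d [e ->]]]] := mx2P A.
rewrite scalar_mx2 !mx2E => detA.
have -> : (a - c) * (e - c) - (b - 0) * (d - 0)
    = (a * e - b * d) - c * (a + e - c) by ring.
rewrite detA => /eqP; rewrite subr_eq0 eq_sym => /eqP e1.
have c0 : c != 0 by apply: contra_eq_neq e1 => ->; rewrite mul0r eq_sym oner_neq0.
by split=> //; apply: (mulfI c0); rewrite [RHS]mulrDr mulfV // -e1; ring.
Qed.

End SL2Matrices.

Section Representations.
Context {T : choiceType} (rel : @word T -> @word T -> Prop).
Local Notation G := (pres_group rel).
Local Notation gen x := (pres_class rel [:: (x, false)]).

Lemma pres_mulgE u v :
  (pres_class rel u * pres_class rel v)%g = pres_class rel (u ++ v).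
Proof. exact: pres_mulE. Qed.

Lemma pres_invgE u : ((pres_class rel u)^-1)%g = pres_class rel (winv u).
Proof. exact: pres_invE. Qed.

Lemma pres_group_ind (P : G -> Prop) : P 1%g ->
  (forall g h, P g -> P h -> P (g * h)%g) -> (forall g, P g -> P g^-1%g) ->
  (forall x, P (gen x)) -> forall g, P g.
Proof.
move=> P1 PM PV Pgen g; rewrite -[g]pres_reprK.
elim: (repr g) => [|[x b] w IHw]; first exact: P1.
rewrite -cat1s -pres_mulgE; apply: PM => //.
by case: b => //; have := PV _ (Pgen x); rewrite pres_invgE.
Qed.

Lemma gen_expg x k : (gen x ^+ k)%g = pres_class rel (gen_pow x k).
Proof.
elim: k => [//|k IHk].
by rewrite expgS IHk pres_mulgE.
Qed.

Section WordEval.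
Context {K : comNzRingType} (A : T -> 'M[K]_2).

(** Inverse letters go to adjugates: these exist over every commutative ring, polynomial rings
    included, and are inverses when the determinant is 1. *)
Definition word_eval (w : @word T) : 'M[K]_2 :=
  foldr (fun xb M => (if xb.2 then \adj (A xb.1) else A xb.1) *m M) 1%:M w.

Lemma word_eval_cat u v : word_eval (u ++ v) = word_eval u *m word_eval v.
Proof.
elim: u => [|xb u IHu] /=; first by rewrite mul1mx.
by rewrite IHu mulmxA.
Qed.

Lemma word_eval_gen_pow x k : word_eval (gen_pow x k) = A x ^+ k.
Proof.
elim: k => [//|k IHk].
by rewrite exprS -IHk.
Qed.

Hypothesis detA : forall x, \det (A x) = 1.
Hypothesis relA : forall u v, rel u v -> word_eval u = word_eval v.

Lemma det_word_eval w : \det (word_eval w) = 1.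
Proof.
have det_adj x : \det (\adj (A x)) = 1.
  have := congr1 determinant (mul_mx_adj (A x)).
  by rewrite det_mulmx detA det1 mul1r.
elim: w => [|[x b] w IHw] /=; first by rewrite det1.
by rewrite det_mulmx IHw mulr1; case: b.
Qed.

Lemma word_eval_pres_eq u v : pres_eq rel u v -> word_eval u = word_eval v.
Proof.
elim=> {u v} [//|//|u v w _ -> _ -> //|u u' v v' _ e _ e'|x b|u v /relA //].
  by rewrite !word_eval_cat e e'.
by case: b; rewrite /= mulmx1 ?mul_mx_adj ?mul_adj_mx detA.
Qed.

Definition pres_rep (g : G) : 'M[K]_2 := word_eval (repr g).

Lemma pres_rep_class w : pres_rep (pres_class rel w) = word_eval w.
Proof. exact/word_eval_pres_eq/pres_repr_class. Qed.

Lemma pres_rep_gen x : pres_rep (gen x) = A x.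
Proof. by rewrite pres_rep_class /= mulmx1. Qed.

Lemma pres_repM g h : pres_rep (g * h)%g = pres_rep g *m pres_rep h.
Proof.
rewrite -[g]pres_reprK -[h]pres_reprK pres_mulgE !pres_rep_class.
exact: word_eval_cat.
Qed.

End WordEval.

Lemma map_word_eval (K L : comNzRingType) (f : {rmorphism K -> L}) (A : T -> 'M[K]_2) w :
  map_mx f (word_eval A w) = word_eval (fun x => map_mx f (A x)) w.
Proof.
elim: w => [|[x b] w IHw] /=; first by rewrite map_mx1.
by rewrite map_mxM IHw; case: b; rewrite ?map_mx_adj.
Qed.

End Representations.

(** * Reducible characters *)

Section SL2Representations.
Context {R : realType} {G : groupType}.
Local Notation C := (R[i]).
Implicit Types (rho : G -> 'M[C]_2).

Lemma SL2_rep_unit rho g : SL2_rep rho -> rho g \in unitmx.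
Proof. by move=> [detr _]; rewrite unitmxE detr unitr1. Qed.

Lemma SL2_rep1 rho : SL2_rep rho -> rho 1%g = 1%:M.
Proof.
move=> rrho; have [_ rM] := rrho; have u1 := SL2_rep_unit 1%g rrho.
by rewrite -[LHS](mulKmx u1) -rM mulg1 mulVmx.
Qed.

Lemma SL2_repVK rho g : SL2_rep rho -> rho g *m rho g^-1%g = 1%:M.
Proof. by move=> rrho; rewrite -rrho.2 mulgV SL2_rep1. Qed.

Lemma SL2_repX rho g k : SL2_rep rho -> rho (g ^+ k)%g = rho g ^+ k.
Proof.
move=> rrho; elim: k => [|k IHk]; first by rewrite SL2_rep1.
by rewrite expgS exprS rrho.2 IHk.
Qed.

Lemma SL2_repV_eigen rho g c (v : 'cV[C]_2) : SL2_rep rho -> c != 0 ->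
  rho g *m v = c *: v -> rho g^-1%g *m v = c^-1 *: v.
Proof.
move=> rrho c0 e; have VK := SL2_repVK g^-1%g rrho; rewrite invgK in VK.
transitivity (rho g^-1%g *m (c^-1 *: (rho g *m v))).
  by rewrite e scalerA mulVf // scale1r.
by rewrite -scalemxAr mulmxA VK mul1mx.
Qed.

Lemma SL2_repX_eigen rho g k c (v : 'cV[C]_2) : SL2_rep rho ->
  rho g *m v = c *: v -> rho (g ^+ k)%g *m v = c ^+ k *: v.
Proof.
move=> rrho e; elim: k => [|k IHk]; first by rewrite SL2_rep1 // mul1mx scale1r.
by rewrite expgS rrho.2 -mulmxA IHk -scalemxAr e scalerA exprSr.
Qed.

End SL2Representations.

Section TorusKnotGroup.
Context {R : realType} {p q m n : nat}.
Local Notation C := (R[i]).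
Local Notation T := (cheb R).
Local Notation U := (@chebU R).
Local Notation G := (torus_knot_group p q).
Local Notation alpha := (pres_class (torus_knot_rel p q) [:: (true, false)] : G).
Local Notation beta := (pres_class (torus_knot_rel p q) [:: (false, false)] : G).
Implicit Types (rho : G -> 'M[C]_2) (x y z t u c : C).

Lemma torus_knot_relE : (alpha ^+ p = beta ^+ q)%g.
Proof.
by rewrite !gen_expg; apply/pres_classP/pres_rel.
Qed.

Lemma torus_knot_ind (P : G -> Prop) : P 1%g ->
  (forall g h, P g -> P h -> P (g * h)%g) -> (forall g, P g -> P g^-1%g) ->
  P alpha -> P beta -> forall g, P g.
Proof. by move=> P1 PM PV Pa Pb; apply: pres_group_ind => // -[]. Qed.

Lemma SL2_rep_rel rho : SL2_rep rho -> rho alpha ^+ p = rho beta ^+ q.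
Proof. by move=> rrho; rewrite -!SL2_repX // torus_knot_relE. Qed.

Definition knot_rep (A B : 'M[C]_2) : G -> 'M[C]_2 :=
  pres_rep (fun b : bool => if b then A else B).

Lemma knot_repP A B : \det A = 1 -> \det B = 1 -> A ^+ p = B ^+ q ->
  [/\ SL2_rep (knot_rep A B), knot_rep A B alpha = A & knot_rep A B beta = B].
Proof.
move=> dA dB AB.
have det1 (b : bool) : \det (if b then A else B) = 1 by case: b.
have rel_eq (w w' : @word bool) : torus_knot_rel p q w w' ->
    word_eval (fun b : bool => if b then A else B) w = word_eval (fun b : bool => if b then A else B) w'.
  by move=> [-> ->]; rewrite !word_eval_gen_pow.
split; [split|exact: pres_rep_gen|exact: pres_rep_gen].
  by move=> g; exact: det_word_eval.
exact: pres_repM.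
Qed.

(** The word [repr g] is fixed, so it is evaluated once over the polynomial ring and then
    specialized at u. *)
Lemma tr_knot_rep_poly (A B : 'M[{poly C}]_2) g : exists P : {poly C}, forall u,
  \tr (knot_rep (map_mx (horner_eval u) A) (map_mx (horner_eval u) B) g) = P.[u].
Proof.
exists (\tr (word_eval (fun b : bool => if b then A else B) (repr g))) => u.
rewrite -[RHS]/(horner_eval u _) -trace_map_mx map_word_eval /knot_rep /pres_rep.
by congr (\tr (word_eval _ _)); apply/funext => -[].
Qed.

Lemma rep_char_intertwined rho rho' (P : 'M[C]_2) : SL2_rep rho -> SL2_rep rho' ->
  P \in unitmx -> rho alpha *m P = P *m rho' alpha -> rho beta *m P = P *m rho' beta ->
  rep_char rho = rep_char rho'.
Proof.
move=> rrho rrho' uP ea eb; apply/funext => g; rewrite /rep_char.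
suff e : rho g *m P = P *m rho' g.
  by rewrite -[rho g](mulmxK uP) e mxtrace_mulC mulmxA mulVmx // mul1mx.
elim/torus_knot_ind: g => // [|g h eg eh|g eg].
- by rewrite !SL2_rep1 // mul1mx mulmx1.
- by rewrite rrho.2 rrho'.2 -mulmxA eh !mulmxA eg.
- have VK := SL2_repVK g^-1%g rrho; rewrite invgK in VK.
  by rewrite -[LHS]mulmx1 -(SL2_repVK g rrho') mulmxA -(mulmxA _ P) -eg !mulmxA VK mul1mx.
Qed.

Lemma common_eigenvector_reducible rho (v : 'cV[C]_2) a b : SL2_rep rho -> v != 0 ->
  rho alpha *m v = a *: v -> rho beta *m v = b *: v -> reducible_rep rho.
Proof.
move=> rrho v0 ea eb; exists v => //; elim/torus_knot_ind.
- by exists 1; rewrite SL2_rep1 // mul1mx scale1r.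
- move=> g h [c ec] [d ed]; exists (d * c).
  by rewrite rrho.2 -mulmxA ed -scalemxAr ec scalerA.
- move=> g [c ec]; exists c^-1; apply: SL2_repV_eigen => //.
  by have [] := eigenvalue_tr (rrho.1 g) v0 ec.
- by exists a.
- by exists b.
Qed.

(** A matrix of determinant 1 with eigenvalue c has trace c + 1/c, so the eigenvalues along one
    invariant line determine the character, even for representations that are not conjugate. *)
Lemma rep_char_common_eigenvalues rho rho' (v v' : 'cV[C]_2) a b :
  SL2_rep rho -> SL2_rep rho' -> v != 0 -> v' != 0 ->
  rho alpha *m v = a *: v -> rho beta *m v = b *: v ->
  rho' alpha *m v' = a *: v' -> rho' beta *m v' = b *: v' ->
  rep_char rho = rep_char rho'.
Proof.
move=> rrho rrho' v0 v'0 ea eb ea' eb'; apply/funext => g; rewrite /rep_char.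
suff [c [ec ec']] : exists c, rho g *m v = c *: v /\ rho' g *m v' = c *: v'.
  have [_ ->] := eigenvalue_tr (rrho.1 g) v0 ec.
  by have [_ ->] := eigenvalue_tr (rrho'.1 g) v'0 ec'.
elim/torus_knot_ind: g.
- by exists 1; rewrite !SL2_rep1 // !mul1mx !scale1r.
- move=> g h [c [ec ec']] [d [ed ed']]; exists (d * c).
  by rewrite rrho.2 rrho'.2 -!mulmxA ed ed' -!scalemxAr ec ec' !scalerA.
- move=> g [c [ec ec']]; exists c^-1.
  have [c0 _] := eigenvalue_tr (rrho.1 g) v0 ec.
  by split; exact: SL2_repV_eigen.
- by exists a.
- by exists b.
Qed.

(** With eigenvalues a and b on an invariant line, both sides are the square of (a - 1/a)(b -
    1/b). *)
Lemma reducible_trace rho : SL2_rep rho -> reducible_rep rho ->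
  (2 * \tr (rho (alpha * beta)%g) - \tr (rho alpha) * \tr (rho beta)) ^+ 2 =
  (\tr (rho alpha) ^+ 2 - 4) * (\tr (rho beta) ^+ 2 - 4).
Proof.
move=> rrho [v v0 ev]; have [a ea] := ev alpha; have [b eb] := ev beta.
have [a0 ->] := eigenvalue_tr (rrho.1 _) v0 ea.
have [b0 ->] := eigenvalue_tr (rrho.1 _) v0 eb.
have eab : rho (alpha * beta)%g *m v = (b * a) *: v.
  by rewrite rrho.2 -mulmxA eb -scalemxAr ea scalerA.
have [_ ->] := eigenvalue_tr (rrho.1 _) v0 eab.
by field; apply/andP.
Qed.

Section ReducibleCharacters.
Hypotheses (bez : (m * p = n * q + 1)%N).

(** Powers of the companion matrix of z^2 - t z + 1 replace diagonal matrices in z and 1/z: the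
    entries, hence the characters, become polynomial in t. *)
Definition abelian_rep t : G -> 'M[C]_2 :=
  knot_rep (mx2 t (-1) 1 0 ^+ q) (mx2 t (-1) 1 0 ^+ p).

Lemma det_companion t : \det (mx2 t (-1) 1 0) = 1.
Proof. by rewrite det_mx2; ring. Qed.

Lemma detX (A : 'M[C]_2) k : \det A = 1 -> \det (A ^+ k) = 1.
Proof.
move=> dA; elim: k => [|k IHk]; first by rewrite expr0 det1.
by rewrite exprS det_mulmx dA IHk mulr1.
Qed.

Lemma abelian_repP t : [/\ SL2_rep (abelian_rep t),
  abelian_rep t alpha = mx2 t (-1) 1 0 ^+ q & abelian_rep t beta = mx2 t (-1) 1 0 ^+ p].
Proof.
apply: knot_repP; [apply: detX; exact: det_companion|apply: detX; exact: det_companion|].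
by rewrite -!exprM mulnC.
Qed.

Lemma mulmxX_eigen (A : 'M[C]_2) c (v : 'cV[C]_2) k :
  A *m v = c *: v -> A ^+ k *m v = c ^+ k *: v.
Proof.
move=> e; elim: k => [|k IHk]; first by rewrite !expr0 mul1mx scale1r.
by rewrite !exprS -[A * _]/(A *m _) -mulmxA IHk -scalemxAr e scalerA mulrC.
Qed.

Lemma abelian_rep_eigen z : z != 0 ->
  cv2 z 1 != 0 /\ abelian_rep (z + z^-1) alpha *m cv2 z 1 = z ^+ q *: cv2 z 1 /\
  abelian_rep (z + z^-1) beta *m cv2 z 1 = z ^+ p *: cv2 z 1.
Proof.
move=> z0; have [_ -> ->] := abelian_repP (z + z^-1).
have e : mx2 (z + z^-1) (-1) 1 0 *m cv2 z 1 = z *: cv2 z 1.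
  by rewrite !mx2E; apply/eq_cv2; split; [field|ring].
split; last by split; exact: mulmxX_eigen.
by apply/eqP; rewrite cv2_0 => /eq_cv2[_ /eqP]; rewrite oner_eq0.
Qed.

Lemma abelian_rep_reducible t : reducible_rep (abelian_rep t).
Proof.
have [z z0 ->] := exists_laurent t.
have [v0 [ea eb]] := abelian_rep_eigen z0; have [rrho _ _] := abelian_repP (z + z^-1).
exact: common_eigenvector_reducible rrho v0 ea eb.
Qed.

(** Since m p - n q = 1, [abelian_rep t] sends this element to the companion matrix itself, whose
    trace is t. *)
Definition char_coord (chi : G -> C) : C := chi (beta ^+ m / alpha ^+ n)%g.

Lemma abelian_charK t : char_coord (rep_char (abelian_rep t)) = t.
Proof.
have [rrho ea eb] := abelian_repP t; rewrite /char_coord /rep_char.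
suff -> : abelian_rep t (beta ^+ m / alpha ^+ n)%g = mx2 t (-1) 1 0.
  by rewrite tr_mx2 addr0.
have VK := SL2_repVK (alpha ^+ n)%g rrho.
rewrite SL2_repX // ea -exprM in VK.
rewrite rrho.2 SL2_repX // eb -exprM (mulnC p) bez addn1 exprS.
by rewrite -[_ * _]/(_ *m _) -mulmxA mulnC VK mulmx1.
Qed.

Lemma abelian_char_poly g : exists P : {poly C}, forall t, rep_char (abelian_rep t) g = P.[t].
Proof.
pose M : 'M[{poly C}]_2 := mx2 'X (-1) 1 0.
have [P eP] := tr_knot_rep_poly (M ^+ q) (M ^+ p) g; exists P => t.
rewrite -eP /rep_char /abelian_rep !rmorphXn /= map_mx2 /= /horner_eval.
by rewrite hornerX hornerN !hornerC.
Qed.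

Lemma char_variety_redE : char_variety_red R G =
  (fun t => rep_char (abelian_rep t)) @` [set t | (1 : {poly C}).[t] != 0].
Proof.
apply/seteqP; split=> chi /=; last first.
  move=> [t _ <-]; exists (abelian_rep t) => //; split; last exact: abelian_rep_reducible.
  by have [] := abelian_repP t.
move=> [rho [rrho [v v0 ev]] ->]; have [a ea] := ev alpha; have [b eb] := ev beta.
have [a0 _] := eigenvalue_tr (rrho.1 _) v0 ea; have [b0 _] := eigenvalue_tr (rrho.1 _) v0 eb.
have eab : a ^+ p = b ^+ q.
  have := SL2_repX_eigen p rrho ea; rewrite torus_knot_relE (SL2_repX_eigen q rrho eb).
  move/eqP; rewrite -subr_eq0 -scalerBl scaler_eq0 (negbTE v0) orbF subr_eq0.
  by move/eqP.
have [z [z0 za zb]] := common_root bez a0 b0 eab.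
exists (z + z^-1); first by rewrite hornerC oner_neq0.
have [v'0 [ea' eb']] := abelian_rep_eigen z0; rewrite za in ea'; rewrite zb in eb'.
have [rab _ _] := abelian_repP (z + z^-1).
exact: rep_char_common_eigenvalues rab rrho v'0 v0 ea' eb' ea eb.
Qed.

Lemma char_red_parametrization : parametrization (char_variety_red R G) 1
  (fun t => rep_char (abelian_rep t)) char_coord.
Proof.
split; [exact: oner_neq0| |exact: polyfun_coord| |exact: char_variety_redE].
  move=> g; have [P eP] := abelian_char_poly g; exists (fun t => P^`().[t]).
  by apply: ratfun_ext (ratfun_poly 1 P) => t //; rewrite eP.
by move=> t _; exact: abelian_charK.
Qed.

Lemma zclosed_char_red : zclosed (char_variety_red R G).
Proof. exact: parametrization_closed char_red_parametrization abelian_char_poly. Qed.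

Lemma abelian_char_alpha t : rep_char (abelian_rep t) alpha = (T q).[t].
Proof.
have [_ ea _] := abelian_repP t; rewrite /rep_char ea tr_exp_mx2 ?det_companion //.
by rewrite tr_mx2 addr0.
Qed.

End ReducibleCharacters.

End TorusKnotGroup.

(** * Irreducible characters *)

Section IrreducibleCharacters.
Context {R : realType} {p q : nat}.
Local Notation C := (R[i]).
Local Notation T := (cheb R).
Local Notation U := (@chebU R).
Local Notation G := (torus_knot_group p q).
Local Notation alpha := (pres_class (torus_knot_rel p q) [:: (true, false)] : G).
Local Notation beta := (pres_class (torus_knot_rel p q) [:: (false, false)] : G).
Implicit Types (rho : G -> 'M[C]_2) (x y z t u c : C).

(** One eigenvalue is fixed for each trace, so it is a constant along the family over a given node.
    The default 1 of [xget] is never reached, by [exists_laurent]. *)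
Definition half_trace_root t : C := xget 1 [set z | z != 0 /\ t = z + z^-1].

Lemma half_trace_rootP t :
  half_trace_root t != 0 /\ t = half_trace_root t + (half_trace_root t)^-1.
Proof.
rewrite /half_trace_root; case: xgetP => [z _ //|h].
by have [z z0 e] := exists_laurent t; case: (h z).
Qed.

Definition is_node x y : Prop :=
  [/\ (U p).[x] = 0, (U q).[y] = 0 & (T p).[x] = (T q).[y]].

Definition node_alpha x : 'M[C]_2 := mx2 (half_trace_root x) 1 0 (half_trace_root x)^-1.
Definition node_beta y u : 'M[C]_2 := mx2 (half_trace_root y) 0 u (half_trace_root y)^-1.
Definition node_rep x y u : G -> 'M[C]_2 := knot_rep (node_alpha x) (node_beta y u).
Definition node_char x y u : G -> C := rep_char (node_rep x y u).
(** The trace of alpha beta at u = 0, the origin of the coordinate u on the family. *)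
Definition node_shift x y : C :=
  half_trace_root x * half_trace_root y + (half_trace_root x)^-1 * (half_trace_root y)^-1.

Lemma det_node_alpha x : \det (node_alpha x) = 1.
Proof. by have [x0 _] := half_trace_rootP x; rewrite det_mx2; field. Qed.

Lemma det_node_beta y u : \det (node_beta y u) = 1.
Proof. by have [y0 _] := half_trace_rootP y; rewrite det_mx2; field. Qed.

Lemma tr_node_alpha x : \tr (node_alpha x) = x.
Proof. by rewrite tr_mx2; have [_] := half_trace_rootP x. Qed.

Lemma tr_node_beta y u : \tr (node_beta y u) = y.
Proof. by rewrite tr_mx2; have [_] := half_trace_rootP y. Qed.

(* Where U_k vanishes at the trace, Cayley-Hamilton makes A ^+ k scalar. *)
Lemma exp_mx2_scalar (A : 'M[C]_2) k : (0 < k)%N -> \det A = 1 -> (U k).[\tr A] = 0 ->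
  A ^+ k = (2^-1 * (T k).[\tr A])%:M.
Proof.
case: k => // k _ dA Uk; rewrite -tr_exp_mx2 // exp_mx2 // Uk scale0r sub0r.
move: (U k).[_] => c; rewrite scalar_mx2 !mx2E scalar_mx2; apply/eq_mx2.
by split; rewrite ?oppr0 //; field.
Qed.

Hypotheses (p_gt0 : (0 < p)%N) (q_gt0 : (0 < q)%N).

Lemma node_repP x y u : is_node x y -> [/\ SL2_rep (node_rep x y u),
  node_rep x y u alpha = node_alpha x & node_rep x y u beta = node_beta y u].
Proof.
move=> [Ux Uy Txy]; apply: knot_repP; rewrite ?det_node_alpha ?det_node_beta //.
rewrite !exp_mx2_scalar ?det_node_alpha ?det_node_beta ?tr_node_alpha ?tr_node_beta //.
by rewrite Txy.
Qed.

Lemma node_char_alpha x y u : is_node x y -> node_char x y u alpha = x.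
Proof. by move=> /(node_repP u)[_ ea _]; rewrite /node_char /rep_char ea tr_node_alpha. Qed.

Lemma node_char_beta x y u : is_node x y -> node_char x y u beta = y.
Proof. by move=> /(node_repP u)[_ _ eb]; rewrite /node_char /rep_char eb tr_node_beta. Qed.

Lemma node_char_alpha_beta x y u : is_node x y ->
  node_char x y u (alpha * beta)%g = u + node_shift x y.
Proof.
move=> /(node_repP u)[rrho ea eb]; rewrite /node_char /rep_char rrho.2 ea eb !mx2E.
by rewrite /node_shift; ring.
Qed.

Lemma node_char_poly x y g : exists P : {poly C}, forall u, node_char x y u g = P.[u].
Proof.
have [P eP] := tr_knot_rep_poly
  (mx2 (half_trace_root x)%:P 1 0 (half_trace_root x)^-1%:P)
  (mx2 (half_trace_root y)%:P 0 'X (half_trace_root y)^-1%:P) g; exists P => u.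
rewrite -eP /node_char /rep_char /node_rep !map_mx2 /= /horner_eval.
by rewrite hornerX !hornerC.
Qed.

(** Expanded, x^2 + y^2 + z^2 - x y z = 4: the commutator of alpha and beta has trace 2. *)
Definition reducible_locus x y z : Prop :=
  (2 * z - x * y) ^+ 2 = (x ^+ 2 - 4) * (y ^+ 2 - 4).

Lemma reducible_locus_node x y u : reducible_locus x y (u + node_shift x y) <->
  u = 0 \/ u = - ((half_trace_root x - (half_trace_root x)^-1) *
                  (half_trace_root y - (half_trace_root y)^-1)).
Proof.
rewrite /reducible_locus /node_shift.
have [a0 ea] := half_trace_rootP x; have [b0 eb] := half_trace_rootP y.
move: (half_trace_root x) (half_trace_root y) a0 b0 ea eb => a b a0 b0 -> ->.
split=> [/eqP|].
  rewrite -subr_eq0 (_ : _ - _ = 4 * (u * (u + (a - a^-1) * (b - b^-1)))); last first.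
    by field; apply/andP.
  rewrite !mulf_eq0 pnatr_eq0 /= addr_eq0.
  by case/orP => /eqP; [left|right].
by case=> ->; field; apply/andP.
Qed.

Lemma node_rep_reducible x y u : is_node x y ->
  reducible_locus x y (u + node_shift x y) -> reducible_rep (node_rep x y u).
Proof.
move=> nxy /reducible_locus_node; have [rrho ea eb] := node_repP u nxy.
have [a0 _] := half_trace_rootP x; have [b0 _] := half_trace_rootP y.
case=> eu.
  apply: (common_eigenvector_reducible (v := cv2 1 0) (a := half_trace_root x)
    (b := half_trace_root y) rrho).
  - by apply/eqP; rewrite cv2_0 => /eq_cv2[/eqP]; rewrite oner_eq0.
  - by rewrite ea !mx2E; apply/eq_cv2; split; ring.
  - by rewrite eb eu !mx2E; apply/eq_cv2; split; ring.
(* For the second value of u the invariant line is the eigenline of [node_alpha] for the inverse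
   eigenvalue; this u is exactly what makes [node_beta] preserve it. *)
apply: (common_eigenvector_reducible
  (v := cv2 1 ((half_trace_root x)^-1 - half_trace_root x)) (a := (half_trace_root x)^-1)
  (b := half_trace_root y) rrho).
- by apply/eqP; rewrite cv2_0 => /eq_cv2[/eqP]; rewrite oner_eq0.
- by rewrite ea !mx2E; apply/eq_cv2; split; ring.
- by rewrite eb eu !mx2E; apply/eq_cv2; split; field; rewrite ?a0 ?b0.
Qed.

Lemma intertwined_reducible rho rho' (P : 'M[C]_2) : SL2_rep rho -> P \in unitmx ->
  rho alpha *m P = P *m rho' alpha -> rho beta *m P = P *m rho' beta ->
  reducible_rep rho' -> reducible_rep rho.
Proof.
move=> rrho uP ea eb [v v0 ev]; have [a eva] := ev alpha; have [b evb] := ev beta.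
apply: (common_eigenvector_reducible (v := P *m v) (a := a) (b := b) rrho).
- by apply: contra_neq v0 => Pv; rewrite -[v](mulKmx uP) Pv mulmx0.
- by rewrite mulmxA ea -mulmxA eva scalemxAr.
- by rewrite mulmxA eb -mulmxA evb scalemxAr.
Qed.

(* The basis adapted to an irreducible rho: w is an eigenvector of rho beta and
   v = rho alpha w - a^-1 w one of rho alpha, by Cayley-Hamilton. *)
Lemma irreducible_normal_form rho : SL2_rep rho -> ~ reducible_rep rho ->
  let x := \tr (rho alpha) in let y := \tr (rho beta) in
  exists u P, [/\ P \in unitmx, rho alpha *m P = P *m node_alpha x,
    rho beta *m P = P *m node_beta y u & u != 0].
Proof.
move=> rrho irr x y; set A := rho alpha; set B := rho beta.
have [a0 ea] := half_trace_rootP x; have [b0 eb] := half_trace_rootP y.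
rewrite /node_alpha /node_beta.
move: (half_trace_root x) (half_trace_root y) a0 b0 ea eb => a b a0 b0 ea eb.
have noeig (w : 'cV[C]_2) c d : w != 0 -> A *m w = c *: w -> B *m w = d *: w -> False.
  move=> w0 Aw Bw; apply: irr; exact: common_eigenvector_reducible rrho w0 Aw Bw.
(* The eigenvalue 1/b is the lower right entry of [node_beta], as w becomes the second basis
   vector. *)
have bV0 : b^-1 != 0 by rewrite invr_eq0.
have [|w w0 Bw] := eigenvector_exists (A := B) bV0 (rrho.1 _).
  by rewrite invrK addrC.
pose v := A *m w - a^-1 *: w.
have Aw : A *m w = v + a^-1 *: w by rewrite subrK.
have Av : A *m v = a *: v.
  have AA : A *m A = (a + a^-1) *: A + (-1)%:M by rewrite -ea sqr_mx2 //; exact: rrho.1.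
  rewrite /v mulmxBr mulmxA AA mulmxDl mul_scalar_mx -scalemxAl -scalemxAr scalerDl.
  rewrite scalerBr scalerA mulfV //.
  by rewrite addrAC addrK scale1r scaleN1r.
have [v1 [v2 ev]] := cv2P v; have [w1 [w2 ew]] := cv2P w.
pose P := mx2 v1 w1 v2 w2.
have mulP (M : 'M[C]_2) c d e f : M *m v = c *: v + d *: w -> M *m w = e *: v + f *: w ->
    M *m P = P *m mx2 c e d f.
  have [m1 [m2 [m3 [m4 ->]]]] := mx2P M; rewrite ev ew !mx2E.
  move=> /eq_cv2[h1 h2] /eq_cv2[h3 h4]; apply/eq_mx2.
  by rewrite h1 h2 h3 h4; split; ring.
(* Otherwise v would be a multiple of w, and w a common eigenvector. *)
have uP : P \in unitmx.
  rewrite unitmxE unitfE; apply/eqP => /det0_kernel[k].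
  have [k1 [k2 ->]] := cv2P k => k0 Pk.
  have lin : k1 *: v + k2 *: w = 0.
    move: Pk; rewrite ev ew cv2_0 !mx2E => /eq_cv2[h1 h2]; apply/eq_cv2.
    by split; [rewrite -[RHS]h1|rewrite -[RHS]h2]; ring.
  have [k10|k10] := eqVneq k1 0.
    move: lin; rewrite k10 scale0r add0r => /eqP; rewrite scaler_eq0 (negbTE w0) orbF => /eqP k20.
    by case/eqP: k0; rewrite cv2_0 k10 k20.
  have ev' : v = (- (k2 / k1)) *: w.
    apply/eqP; rewrite -(inj_eq (scalerI k10)) scalerA; apply/eqP.
    by rewrite mulrN mulrCA mulfV // mulr1 scaleNr; apply/eqP; rewrite -addr_eq0 lin.
  apply: (noeig w (- (k2 / k1) + a^-1) b^-1) => //.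
  by rewrite scalerDl -ev' -Aw.
have [u [d Bv]] : exists u d, B *m v = d *: v + u *: w.
  pose k := invmx P *m (B *m v); have [k1 [k2 ek]] := cv2P k.
  exists k2, k1; rewrite -[LHS](mulKVmx uP) -/k ek ev ew !mx2E.
  by apply/eq_cv2; split; ring.
have BP : B *m P = P *m mx2 d 0 u b^-1.
  by apply: mulP; rewrite // scale0r add0r.
(* The trace of beta forces the remaining diagonal entry. *)
have db : d = b.
  have : \tr B = \tr (mx2 d 0 u b^-1).
    by rewrite -[B](mulmxK uP) BP mxtrace_mulC mulmxA mulVmx // mul1mx.
  by rewrite tr_mx2 -/y eb => /addIr.
have v0 : v != 0.
  apply/eqP => v0; apply: (noeig w a^-1 b^-1) => //.
  by rewrite Aw v0 add0r.
exists u, P; split=> //.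
- apply: mulP; first by rewrite scale0r addr0.
  by rewrite scale1r.
- by rewrite BP db.
- apply/eqP => u0; apply: (noeig v a d) => //.
  by rewrite Bv u0 scale0r addr0.
Qed.

Lemma irreducible_node rho : SL2_rep rho -> ~ reducible_rep rho ->
  is_node (\tr (rho alpha)) (\tr (rho beta)).
Proof.
move=> rrho irr; have [u [P [uP ea eb u0]]] := irreducible_normal_form rrho irr.
move: ea eb; set x := \tr _; set y := \tr _ => ea eb.
have conjX (M N : 'M[C]_2) k : M *m P = P *m N -> M ^+ k *m P = P *m N ^+ k.
  move=> e; elim: k => [|k IHk]; first by rewrite !expr0 mul1mx mulmx1.
  by rewrite !exprS -[M * _]/(M *m _) -[N * _]/(N *m _) -mulmxA IHk !mulmxA e.
have e : node_alpha x ^+ p = node_beta y u ^+ q.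
  rewrite -[LHS](mulKmx uP) -[RHS](mulKmx uP).
  by rewrite -(conjX _ _ _ ea) -(conjX _ _ _ eb) (SL2_rep_rel rrho).
have trx : (T p).[x] = (T q).[y].
  rewrite -{1}(tr_node_alpha x) -(tr_node_beta y u) -!tr_exp_mx2 ?e //.
    exact: det_node_beta.
  exact: det_node_alpha.
have [k ek] : exists k, p = k.+1 by exists p.-1; rewrite prednK.
have [l el] : exists l, q = l.+1 by exists q.-1; rewrite prednK.
have : node_alpha x ^+ k.+1 = node_beta y u ^+ l.+1 by rewrite -ek -el.
rewrite !exp_mx2 ?det_node_alpha ?det_node_beta // tr_node_alpha tr_node_beta -ek -el.
rewrite !scalar_mx2 !mx2E => /eq_mx2[_]; rewrite !mulr0 !mulr1 !subr0 => Ux /esym/eqP.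
by rewrite mulf_eq0 (negbTE u0) orbF => /eqP Uy _.
Qed.

(** Irreducibility is visible on the character: [reducible_trace] makes the locus equation necessary
    for reducibility, and [node_rep_reducible] exhibits an invariant line whenever it holds. *)
Lemma char_irrP (chi : G -> C) : char_variety_irr R G chi <-> exists x y u,
  [/\ is_node x y, ~ reducible_locus x y (u + node_shift x y) & chi = node_char x y u].
Proof.
split=> [[rho [rrho irr] ->]|[x [y [u [nxy nred ->]]]]].
  have nxy := irreducible_node rrho irr.
  have [u [P [uP ea eb _]]] := irreducible_normal_form rrho irr.
  move: nxy ea eb; set x := \tr _; set y := \tr _ => nxy ea eb.
  have [rn ena enb] := node_repP u nxy; rewrite -ena in ea; rewrite -enb in eb.
  exists x, y, u; split=> //; last exact: rep_char_intertwined rrho rn uP ea eb.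
  move=> /(node_rep_reducible nxy) red; apply: irr.
  exact: intertwined_reducible rrho uP ea eb red.
have [rn ena enb] := node_repP u nxy; exists (node_rep x y u) => //; split=> // red.
apply: nred; have := reducible_trace rn red.
rewrite -[\tr _]/(node_char x y u _) node_char_alpha_beta //.
by rewrite -[\tr (_ alpha)]/(node_char x y u _) node_char_alpha // -[\tr _]/(node_char x y u _) node_char_beta.
Qed.

Definition node_curve x y : set (G -> C) :=
  node_char x y @` [set t | (1 : {poly C}).[t] != 0].

Definition node_coord x y (chi : G -> C) : C := chi (alpha * beta)%g + - node_shift x y.

Lemma node_curveP x y chi : node_curve x y chi <-> exists u, chi = node_char x y u.
Proof.
split=> [[u _ <-]|[u ->]]; exists u => //.
by rewrite /= hornerC oner_neq0.
Qed.

Lemma node_parametrization x y : is_node x y ->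
  parametrization (node_curve x y) 1 (node_char x y) (node_coord x y).
Proof.
move=> nxy; split=> //; first exact: oner_neq0.
- move=> g; have [P eP] := node_char_poly x y g; exists (fun t => P^`().[t]).
  by apply: ratfun_ext (ratfun_poly 1 P) => t //; rewrite eP.
- by apply: polyfunD; [exact: polyfun_coord|exact: polyfun_cst].
- by move=> u _; rewrite /node_coord node_char_alpha_beta // addrK.
Qed.

Lemma zclosed_node_curve x y : is_node x y -> zclosed (node_curve x y).
Proof.
by move=> nxy; apply: parametrization_closed (node_parametrization nxy) (node_char_poly x y).
Qed.

Lemma node_curve_inj x y x' y' : is_node x y -> is_node x' y' ->
  node_curve x y `<=` node_curve x' y' -> x = x' /\ y = y'.
Proof.
move=> nxy nxy' sub; have /sub/node_curveP[u e] : node_curve x y (node_char x y 0).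
  by apply/node_curveP; exists 0.
have := node_char_alpha 0 nxy; have := node_char_beta 0 nxy.
by rewrite e node_char_alpha // node_char_beta.
Qed.

(** The locus equation holds only at u = 0 and at one further value, and u = 1 and u = 2 cannot both
    be that value. *)
Lemma node_curve_not_sub_red x y : is_node x y ->
  ~ (node_curve x y `<=` char_variety_red R G).
Proof.
move=> nxy sub.
pose c := (half_trace_root x - (half_trace_root x)^-1) *
          (half_trace_root y - (half_trace_root y)^-1).
have locus u : reducible_locus x y (u + node_shift x y).
  have [|rho [rrho red] e] := sub (node_char x y u).
    by apply/node_curveP; exists u.
  have := reducible_trace rrho red.
  rewrite -![\tr _]/(rep_char rho _) -e.
  by rewrite node_char_alpha_beta // node_char_alpha // node_char_beta.
have [/eqP|e1] := (reducible_locus_node x y 1).1 (locus 1); first by rewrite oner_eq0.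
have [/eqP|e2] := (reducible_locus_node x y 2).1 (locus 2); first by rewrite pnatr_eq0.
by have /eqP := etrans e2 (esym e1); rewrite (eqr_nat _ 2 1).
Qed.

Lemma char_varietyE : char_variety R G = char_variety_red R G `|`
  [set chi | exists x y, is_node x y /\ node_curve x y chi].
Proof.
apply/seteqP; split=> chi /=.
  move=> [rho rrho ->]; have [red|irr] := pselect (reducible_rep rho).
    by left; exists rho.
  right; have [|x [y [u [nxy _ ->]]]] := (char_irrP (rep_char rho)).1; first by exists rho.
  by exists x, y; split=> //; apply/node_curveP; exists u.
move=> [[rho [rrho _] ->]|[x [y [nxy /node_curveP[u ->]]]]]; first by exists rho.
by exists (node_rep x y u) => //; have [] := node_repP u nxy.
Qed.

End IrreducibleCharacters.

Arguments is_node {R} p q x y.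

(** * Comparison *)

Section Comparison.
Context {R : realType} {p q m n : nat}.
Local Notation C := (R[i]).
Local Notation U := (@chebU R).
Local Notation G := (torus_knot_group p q).
Local Notation alpha := (pres_class (torus_knot_rel p q) [:: (true, false)] : G).
Local Notation beta := (pres_class (torus_knot_rel p q) [:: (false, false)] : G).
Local Notation cX v := (v (lshift 1 (ord0 : 'I_2))).
Local Notation cY v := (v (lshift 1 (ord_max : 'I_2))).
Local Notation cW v := (v (ord_max : 'I_3)).
Local Notation is_node := (is_node p q).
Hypotheses (p_gt0 : (0 < p)%N) (q_gt0 : (0 < q)%N).
Hypotheses (bez : (m * p = n * q + 1)%N) (co_pq : coprime p q).

Let p0 : p%:R != 0 :> C. Proof. by rewrite pnatr_eq0 -lt0n. Qed.
Let q0 : q%:R != 0 :> C. Proof. by rewrite pnatr_eq0 -lt0n. Qed.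

Lemma cheb_sing_node (s : 'I_2 -> C) : cheb_sing R p q s <-> is_node (s ord0) (s ord_max).
Proof. exact: cheb_singE. Qed.

Definition char_to_blowup (chi : G -> C) : 'I_3 -> C :=
  pt3 (chi alpha) (chi beta)
    (q%:R / p%:R * (2 * chi (alpha * beta)%g - chi alpha * chi beta) / (chi beta ^+ 2 - 4)).

(* The slope w fixes z = tr (alpha beta) through 2z - xy = (p/q) w (y^2 - 4). *)
Definition blowup_trace (v : 'I_3 -> C) : C :=
  2^-1 * (cX v * cY v + slope p q v * (cY v ^+ 2 - 4)).

Definition blowup_to_char (v : 'I_3 -> C) : G -> C :=
  node_char (cX v) (cY v) (blowup_trace v - node_shift (cX v) (cY v)).

Let node_beta_neq (x y : C) : is_node x y -> y ^+ 2 - 4 != 0.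
Proof. by move=> [_ Uy _]; exact: chebU_root_neq Uy. Qed.

(** Over a node, dividing the locus equation by the nonzero Y^2 - 4 gives the equation of D in
    [proper_nodeP]; away from the nodes every point of Y lies on D. *)
Lemma Y_minus_DP (v : 'I_3 -> C) : (Ycurve R p q `\` Dcurve R p q) v <->
  is_node (cX v) (cY v) /\ ~ reducible_locus (cX v) (cY v) (blowup_trace v).
Proof.
have locus : is_node (cX v) (cY v) ->
    Dcurve R p q v <-> reducible_locus (cX v) (cY v) (blowup_trace v).
  move=> nv; have sv : cheb_sing R p q (chart v).1 by apply/cheb_sing_node; rewrite chart1.
  have Y0 := node_beta_neq nv.
  rewrite (DcurveE p_gt0 q_gt0 bez co_pq).
  apply: (iff_trans (proper_nodeP p_gt0 q_gt0 bez co_pq sv)).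
  rewrite /reducible_locus /blowup_trace.
  have -> : 2 * (2^-1 * (cX v * cY v + slope p q v * (cY v ^+ 2 - 4))) - cX v * cY v =
    slope p q v * (cY v ^+ 2 - 4) by field.
  split=> [<-|e]; first by ring.
  by apply: (mulIf Y0); rewrite -e; ring.
split=> [[Yv nDv]|[nv nred]].
  have nv : is_node (cX v) (cY v).
    have [/cheb_sing_node|nsv] := pselect (cheb_sing R p q (chart v).1).
      by rewrite chart1.
    case: nDv; rewrite (DcurveE p_gt0 q_gt0 bez co_pq).
    exact: (Y_smooth_sub_proper p_gt0 q_gt0 bez co_pq Yv).
  by split=> // red; apply: nDv; exact/locus.
split=> [|/(locus nv) //].
by apply/YcurveE; have [-> -> ->] := nv; rewrite !mulr0 mul0r.
Qed.

Lemma blowup_trace_char x y u : is_node x y ->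
  blowup_trace (char_to_blowup (node_char x y u)) = u + node_shift x y.
Proof.
move=> nxy; have y0 := node_beta_neq nxy.
rewrite /blowup_trace /char_to_blowup /slope /pt3 /=.
rewrite node_char_alpha // node_char_beta // node_char_alpha_beta //.
by field; apply/and3P; split.
Qed.

Lemma blowup_to_charK x y u : is_node x y ->
  blowup_to_char (char_to_blowup (node_char x y u)) = node_char x y u.
Proof.
move=> nxy; rewrite /blowup_to_char blowup_trace_char // /char_to_blowup /pt3 /=.
by rewrite node_char_alpha // node_char_beta // addrK.
Qed.

Lemma char_to_blowupK v : is_node (cX v) (cY v) -> char_to_blowup (blowup_to_char v) = v.
Proof.
move=> nv; have Y0 := node_beta_neq nv; rewrite [RHS]pt3_eta /char_to_blowup /blowup_to_char.
rewrite node_char_alpha // node_char_beta // node_char_alpha_beta // subrK.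
congr (pt3 _ _ _); rewrite /blowup_trace /slope.
by field; apply/and3P; split.
Qed.

Lemma polyfun_blowup_trace : polyfun blowup_trace.
Proof.
apply: polyfunM; first exact: polyfun_cst.
apply: polyfunD; first by apply: polyfunM; exact: polyfun_coord.
apply: polyfunM; first exact: polyfun_slope.
by apply: polyfunD; [apply: polyfunX; exact: polyfun_coord|exact: polyfun_cst].
Qed.

Lemma regular_char_to_blowup i :
  regular_on (char_variety_irr R G) (fun chi => char_to_blowup chi i).
Proof.
case: i => -[|[|[|//]]] lti; try exact/regular_on_polyfun/polyfun_coord.
move=> _ /(char_irrP p_gt0 q_gt0)[x [y [u [nxy _ ->]]]].
exists (fun chi => q%:R / p%:R * (2 * chi (alpha * beta)%g - chi alpha * chi beta)).
exists (fun chi => chi beta ^+ 2 - 4); split=> //.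
- apply: polyfunM; first exact: polyfun_cst.
  apply: polyfunD; first by apply: polyfunM; [exact: polyfun_cst|exact: polyfun_coord].
  by apply: polyfunN; apply: polyfunM; exact: polyfun_coord.
- by apply: polyfunD; [apply: polyfunX; exact: polyfun_coord|exact: polyfun_cst].
- by rewrite node_char_beta //; exact: node_beta_neq nxy.
Qed.

(* The formula for the inverse map depends on the node; multiplying numerator
   and denominator by a polynomial vanishing at all other nodes makes it valid
   on the whole of the curve. *)
Lemma regular_blowup_to_char g :
  regular_on (Ycurve R p q `\` Dcurve R p q) (fun v => blowup_to_char v g).
Proof.
move=> v /Y_minus_DP[nv _].
have [F eF] := node_char_poly (cX v) (cY v) g.
have [P1 P1v sepX] := chebU_separator (cX v) p_gt0.
have [P2 P2v sepY] := chebU_separator (cY v) q_gt0.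
exists (fun w => P1.[cX w] * P2.[cY w] * F.[blowup_trace w + - node_shift (cX v) (cY v)]).
exists (fun w => P1.[cX w] * P2.[cY w]).
have pQ : polyfun (fun w : 'I_3 -> C => P1.[cX w] * P2.[cY w]).
  by apply: polyfunM; apply: polyfun_horner; exact: polyfun_coord.
split=> //.
- apply: polyfunM => //; apply: polyfun_horner; apply: polyfunD; last exact: polyfun_cst.
  exact: polyfun_blowup_trace.
- exact: mulf_neq0.
move=> w /Y_minus_DP[[Uw Uw' _] _] Qw.
have [Q1w Q2w] : P1.[cX w] != 0 /\ P2.[cY w] != 0.
  by move: Qw; rewrite mulf_eq0 negb_or => /andP.
rewrite /blowup_to_char mulrC mulKf // (sepX _ Uw Q1w) (sepY _ Uw' Q2w).
exact: eF.
Qed.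

Lemma irr_isomorphic : isomorphic (char_variety_irr R G) (Ycurve R p q `\` Dcurve R p q).
Proof.
exists char_to_blowup, blowup_to_char; split.
- split; last exact: regular_char_to_blowup.
  move=> _ /(char_irrP p_gt0 q_gt0)[x [y [u [nxy nred ->]]]]; apply/Y_minus_DP.
  rewrite blowup_trace_char // /char_to_blowup /pt3 /=.
  by rewrite node_char_alpha // node_char_beta.
- split; last exact: regular_blowup_to_char.
  move=> v /Y_minus_DP[nv nred]; apply/(char_irrP p_gt0 q_gt0).
  by exists (cX v), (cY v), (blowup_trace v - node_shift (cX v) (cY v)); rewrite subrK.
- by move=> _ /(char_irrP p_gt0 q_gt0)[x [y [u [nxy _ ->]]]]; exact: blowup_to_charK.
- by move=> v /Y_minus_DP[nv _]; exact: char_to_blowupK.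
Qed.

Lemma red_birational : birational (char_variety_red R G) (Dcurve R p q).
Proof.
rewrite (DcurveE p_gt0 q_gt0 bez co_pq).
apply: parametrization_birational; first exact: char_red_parametrization bez.
exact: proper_parametrization p_gt0 q_gt0 bez.
Qed.

(** The trace of alpha is constant on a node family but equals C_q(t) on the reducible
    characters. *)
Lemma red_not_sub_node_curve x y : is_node x y -> ~ (char_variety_red R G `<=` node_curve x y).
Proof.
move=> nxy sub.
have N0 : cheb R q - x%:P != 0.
  by rewrite -size_poly_gt0 size_polyDl size_cheb // size_polyN size_polyC ltnS (leq_trans (leq_b1 _)).
have [t [_]] := parametrization_nonroot (char_red_parametrization bez) N0.
rewrite hornerD hornerN hornerC -(abelian_char_alpha (p := p)).
have [|u ->] := (node_curveP x y _).1 (sub (rep_char (abelian_rep t)) _).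
  by rewrite (char_variety_redE bez); exists t; rewrite //= hornerC oner_neq0.
by rewrite node_char_alpha // subrr eqxx.
Qed.

Section NodeList.
Variable ns : seq (C * C).
Hypotheses (uniq_ns : uniq ns) (mem_ns : forall s, (s \in ns) =
  [&& (U p).[s.1] == 0, (U q).[s.2] == 0 & (cheb R p).[s.1] == (cheb R q).[s.2]]).

Local Notation node j := (nth (0, 0) ns j).

Lemma nth_node j : (j < size ns)%N -> is_node (node j).1 (node j).2.
Proof.
move=> jn; have := mem_nth (0, 0) jn; rewrite mem_ns.
by move=> /and3P[/eqP ? /eqP ? /eqP ?].
Qed.

Lemma is_node_nth x y : is_node x y -> exists2 j, (j < size ns)%N & node j = (x, y).
Proof.
move=> [Ux Uy Txy]; have xy : (x, y) \in ns by rewrite mem_ns /= Ux Uy Txy !eqxx.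
by exists (index (x, y) ns); rewrite ?index_mem // nth_index.
Qed.

Lemma nth_node_inj i j : (i < size ns)%N -> (j < size ns)%N -> node i = node j -> i = j.
Proof. by move=> lin jn /eqP; rewrite nth_uniq // => /eqP. Qed.

Lemma cheb_sing_nth : cheb_sing R p q = (fun j => pt2 (node j).1 (node j).2) @` `I_(size ns).
Proof.
apply/seteqP; split=> s.
  by move=> /cheb_sing_node/is_node_nth[j jn e]; exists j; rewrite // e [RHS]pt2_eta.
by move=> [j jn <-]; apply/cheb_sing_node; exact: nth_node.
Qed.

Lemma card_exceptional_lines : exceptional_lines R p q #= `I_(size ns).
Proof.
rewrite /exceptional_lines.
have inj_line : {in cheb_sing R p q &, injective (exceptional_line R p q)}.
  move=> s s' /[!inE] ss ss' e; apply: (exceptional_line_inj p_gt0 q_gt0 ss ss').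
  by rewrite e.
apply: (card_eq_trans (inj_card_eq inj_line)); rewrite cheb_sing_nth.
apply: inj_card_eq => i j /[!inE] lin jn e; apply: nth_node_inj => //.
have := congr1 (fun s => s ord0) e; have := congr1 (fun s => s ord_max) e.
rewrite /pt2 /=; case: (node i) (node j) => [? ?] [? ?] /=.
by move=> -> ->.
Qed.

(** The numbering realizes the matching of components: 0 is the reducible part, paired with D, and j
    + 1 is the family of node j, paired with the exceptional line over that node. *)
Let char_component j : set (G -> C) :=
  if j is j'.+1 then node_curve (node j').1 (node j').2 else char_variety_red R G.

Let blowup_component j : set ('I_3 -> C) :=
  if j is j'.+1 then exceptional_line R p q (pt2 (node j').1 (node j').2)
  else Dcurve R p q.

Lemma components_birational : birational_by_components (char_variety R G) (Ycurve R p q).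
Proof.
have sing j : (j < size ns)%N -> cheb_sing R p q (pt2 (node j).1 (node j).2).
  by move=> jn; apply/cheb_sing_node; exact: nth_node.
have DE := DcurveE p_gt0 q_gt0 bez co_pq.
apply: (@birational_by_components_bigcup _ _ _ _ _ (size ns).+1 char_component blowup_component).
- case=> [|j] jn; first exact: parametrization_irreducible (char_red_parametrization bez).
  exact: parametrization_irreducible (node_parametrization p_gt0 q_gt0 (nth_node jn)).
- case=> [|j] jn; first exact: zclosed_char_red bez.
  exact: zclosed_node_curve p_gt0 q_gt0 _ _ (nth_node jn).
- move=> [|i] [|j] //= lin jn.
  + by move/(red_not_sub_node_curve (nth_node jn)).
  + by move/(node_curve_not_sub_red p_gt0 q_gt0 (nth_node lin)).
  + move/(node_curve_inj p_gt0 q_gt0 (nth_node lin) (nth_node jn)) => [e1 e2].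
    by congr S; apply: nth_node_inj => //; rewrite [node i]surjective_pairing e1 e2 -surjective_pairing.
- rewrite char_varietyE //; apply/seteqP; split=> chi.
    move=> [red|[x [y [/is_node_nth[j jn e] chij]]]]; first by exists 0%N.
    by exists j.+1; rewrite //= e.
  move=> [[|j] jn]; first by left.
  by right; exists (node j).1, (node j).2; split=> //; exact: nth_node.
- case=> [|j] jn.
    rewrite /= DE; exact: parametrization_irreducible (proper_parametrization p_gt0 q_gt0 bez).
  exact: parametrization_irreducible (exceptional_parametrization p_gt0 q_gt0 (sing j jn)).
- case=> [|j] jn; first by rewrite /= DE; exact: zclosed_proper p_gt0 q_gt0 bez co_pq.
  exact: zclosed_exceptional p_gt0 q_gt0 _ (sing j jn).
- move=> [|i] [|j] //= lin jn; rewrite ?DE.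
  + by move/(proper_not_sub_exceptional p_gt0 q_gt0 bez).
  + by move/(exceptional_not_sub_proper p_gt0 q_gt0 bez co_pq (sing i lin)).
  + move/(exceptional_line_inj p_gt0 q_gt0 (sing i lin) (sing j jn)) => e.
    congr S; apply: nth_node_inj => //.
    have := congr1 (fun s => s ord0) e; have := congr1 (fun s => s ord_max) e.
    by rewrite /pt2 /=; case: (node i) (node j) => [? ?] [? ?] /= -> ->.
- rewrite (Y_decomposition p_gt0 q_gt0 bez co_pq) -DE; apply/seteqP; split=> v.
    move=> [Dv|[s]]; first by exists 0%N.
    by rewrite cheb_sing_nth => -[j jn <-] sv; exists j.+1.
  move=> [[|j] jn]; first by left.
  by right; exists (pt2 (node j).1 (node j).2) => //; exact: sing.
- case=> [|j] jn; first exact: red_birational.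
  exact: parametrization_birational (node_parametrization p_gt0 q_gt0 (nth_node jn))
    (exceptional_parametrization p_gt0 q_gt0 (sing j jn)).
Qed.

End NodeList.
End Comparison.

Theorem theorem2p8 (R : realType) (p q : nat)
    (p_gt0 : (0 < p)%N) (q_gt0 : (0 < q)%N)
    (co_pq : coprime p q) (odd_q : odd q) :
  (Ycurve R p q =
     Dcurve R p q `|` \bigcup_(L in exceptional_lines R p q) L /\
   nonsingular_curve (Dcurve R p q) /\
   exceptional_lines R p q #= `I_(p.-1 * q.-1 %/ 2) /\
   (forall L, exceptional_lines R p q L -> affine_line L)) /\
  (birational_by_components
     (char_variety R (torus_knot_group p q)) (Ycurve R p q) /\
   birational (char_variety_red R (torus_knot_group p q)) (Dcurve R p q) /\
   isomorphic (char_variety_irr R (torus_knot_group p q))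
     (Ycurve R p q `\` Dcurve R p q)).
Proof.
have [m n bez _] := egcdnP q p_gt0; rewrite (eqP co_pq) in bez.
have [ns [uns <- mem_ns]] := cheb_nodes (R := R) p_gt0 odd_q.
have DE := DcurveE (R := R) p_gt0 q_gt0 bez co_pq.
split; split.
- by rewrite bigcup_image (Y_decomposition p_gt0 q_gt0 bez co_pq) -DE.
- split; first by rewrite DE; exact: proper_nonsingular p_gt0 q_gt0 bez co_pq.
  split; first exact: card_exceptional_lines.
  by move=> _ [s ss <-]; exact: exceptional_affine.
- exact: components_birational bez co_pq _ uns mem_ns.
- split; first exact: red_birational bez co_pq.
  exact: irr_isomorphic bez co_pq.
Qed.
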